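(* Let $(\phi^k,\vartheta^k)_{k\ge0}$, $\vartheta^k=(u^k,v^k)$, be the iHDG iterates for one backward Euler step (step size $\Delta t>0$) of the homogeneous two-dimensional linearized shallow water system, as defined in the context, started from an arbitrary initial guess $(\phi^0,\vartheta^0)$. Let $$\mathcal{A}=\max\Big\{\tfrac{\Phi+\sqrt\Phi}{2},\tfrac{1+\sqrt\Phi}{2}\Big\},$$ $$\mathcal{B}=\min\Big\{\tfrac{ch}{\Delta t(p+1)(p+2)}+\tfrac{\sqrt\Phi-\Phi}{2},\ \big(\gamma+\tfrac1{\Delta t}\big)\tfrac{ch}{(p+1)(p+2)}-\tfrac{1+\sqrt\Phi}{2}\Big\},\qquad \mathcal{C}=\frac{\mathcal{A}}{\mathcal{B}}.$$ Assume that the mesh size $h$, the time step $\Delta t$ and the solution order $p$ are chosen such that $\mathcal{B}>0$ and $\mathcal{C}<1$. Then $(\phi^k,\vartheta^k)$ converges to zero; more precisely, for all $k\ge1$, $$\|(\phi^k,\vartheta^k)\|^2_{\mathcal{E}_h}\le\mathcal{C}^k\,\|(\phi^0,\vartheta^0)\|^2_{\mathcal{E}_h},\qquad \|(\phi^k,\vartheta^k)\|^2_{\Omega_h}\le\Delta t\,\mathcal{A}(\mathcal{C}+1)\,\mathcal{C}^{k-1}\,\|(\phi^0,\vartheta^0)\|^2_{\mathcal{E}_h}.$$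
   Context: Let $\Omega\subset\mathbb{R}^2$ be open and bounded, partitioned into finitely many non-overlapping (tensor product) elements $K$ with Lipschitz boundaries, forming the mesh $\Omega_h$ with skeleton $\mathcal{E}_h$ (set of faces) and maximal element diameter $h$. $\mathcal{P}^p(K)$ is the space of polynomials of degree at most $p$ on $K$; $(\cdot,\cdot)_K$, $\langle\cdot,\cdot\rangle_{\partial K}$ are $L^2$ inner products; $n=(n_1,n_2)$ is the outward unit normal. $\Phi>0$ is a constant mean geopotential height, $\gamma\ge0$ the constant bottom friction, $f=f_0+\beta_0(y-y_m)$ the Coriolis parameter with given constants $f_0,\beta_0,y_m$. The constant $0<c\le1$ is that of the inverse trace inequality: $(w,w)_K\ge\frac{2ch}{d(p+1)(p+2)}\langle w,w\rangle_{\partial K}$ with $d=2$, for all $K$ and all $w\in\mathcal{P}^p(K)$. Homogeneous iHDG iteration (zero initial/previous-time data, zero forcing, zero wind stress, zero boundary data): given $(\phi^k,\vartheta^k)$ piecewise polynomial of degree $\le p$, for each $K$ find $\phi^{k+1},u^{k+1},v^{k+1}\in\mathcal{P}^p(K)$ such that for all $\varphi_1,\varphi_2,\varphi_3\in\mathcal{P}^p(K)$ $$\big(\tfrac{\phi^{k+1}}{\Delta t},\varphi_1\big)_K-(\Phi\vartheta^{k+1},\nabla\varphi_1)_K+\langle\Phi\vartheta^{k+1}\cdot n+\sqrt\Phi(\phi^{k+1}-\hat\phi^k),\varphi_1\rangle_{\partial K}=0,$$ $$\big(\tfrac{\Phi u^{k+1}}{\Delta t},\varphi_2\big)_K-(\Phi\phi^{k+1},\partial_x\varphi_2)_K+\langle\Phi\hat\phi^kn_1,\varphi_2\rangle_{\partial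 K}=(f\Phi v^{k+1}-\gamma\Phi u^{k+1},\varphi_2)_K,$$ $$\big(\tfrac{\Phi v^{k+1}}{\Delta t},\varphi_3\big)_K-(\Phi\phi^{k+1},\partial_y\varphi_3)_K+\langle\Phi\hat\phi^kn_2,\varphi_3\rangle_{\partial K}=(-f\Phi u^{k+1}-\gamma\Phi v^{k+1},\varphi_3)_K,$$ where $\hat\phi^k=\{\!\{\phi^k\}\!\}+\sqrt\Phi\{\!\{\vartheta^k\cdot n\}\!\}$, with $\{\!\{\phi\}\!\}=\tfrac12(\phi^-+\phi^+)$ and $\{\!\{\vartheta\cdot n\}\!\}=\tfrac12(\vartheta^-\cdot n^-+\vartheta^+\cdot n^+)$ on a face shared by $K^\pm$ with outward normals $n^\pm$; on boundary faces the exterior state is zero. Norms: $\|(\phi,\vartheta)\|^2_{\Omega_h}=\sum_K\big(\|\phi\|^2_{L^2(K)}+\|\sqrt\Phi\,\vartheta\|^2_{L^2(K)}\big)$ and $\|(\phi,\vartheta)\|^2_{\mathcal{E}_h}=\sum_K\big(\|\phi\|^2_{L^2(\partial K)}+\|\sqrt\Phi\,\vartheta\|^2_{L^2(\partial K)}\big)$ (both traces counted on interior faces). *)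

(* Defs.v *)
From HB Require Import structures.
From mathcomp Require Import all_boot all_order all_algebra.
(* The notations of multinomials clash with those of MathComp-Analysis. *)
From mathcomp Require Import -(notations) mpoly.
From mathcomp Require Import all_classical all_reals all_analysis.

Set Implicit Arguments.
Unset Strict Implicit.
Unset Printing Implicit Defensive.

Import Order.TTheory GRing.Theory Num.Theory numFieldNormedType.Exports.

Local Open Scope classical_set_scope.
Local Open Scope ring_scope.

Notation point R := (Real.sort R * Real.sort R)%type.

(* [point R] with the Borel structure on which the product measure
   [lebesgue_measure \x lebesgue_measure] is defined. *)
Notation plane R := (measurableTypeR R * measurableTypeR R)%type.

Notation area R := (@lebesgue_measure R \x @lebesgue_measure R)%E.

Section Geometry.
Variable R : realType.
Implicit Types (A K : set (point R)) (x y : point R).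

Definition bd A : set (point R) := closure A `\` A°.

(* The norm of the library on [R * R] is the sup norm. *)
Definition edist x y : R :=
  Num.sqrt ((x.1 - y.1) ^+ 2 + (x.2 - y.2) ^+ 2).

Definition diam A : R := sup [set edist z.1 z.2 | z in A `*` A].

(* Data of a local description of a boundary as a Lipschitz graph: in the
   coordinates (a, b) of the positively oriented orthonormal frame with origin
   [org] and first vector [dir], the set K is {b < graph a} inside the open
   rectangle |a| < rad, |b| < hgt.  [slope] is a Borel version of the
   derivative of [graph], which exists almost everywhere by Rademacher's
   theorem. *)
Record chart := Chart {
  org : point R;
  dir : point R;
  rad : R;
  hgt : R;
  graph : R -> R;
  slope : R -> R
}.

Definition frame (c : chart) (a b : R) : point R :=
  ((org c).1 + a * (dir c).1 - b * (dir c).2,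
   (org c).2 + a * (dir c).2 + b * (dir c).1).

Definition graph_pt (c : chart) (a : R) : point R := frame c a (graph c a).

Record is_lipschitz_chart K (c : chart) : Prop := {
  chart_dir : (dir c).1 ^+ 2 + (dir c).2 ^+ 2 = 1;
  chart_rad : 0 < rad c;
  chart_hgt : 0 < hgt c;
  chart_graph : exists L : R, L.-lipschitz (graph c);
  chart_in_box : forall a, `|a| < rad c -> `|graph c a| < hgt c;
  chart_subgraph : forall a b, `|a| < rad c -> `|b| < hgt c ->
    (K (frame c a b) <-> b < graph c a);
  chart_slope_meas : measurable_fun [set: R] (slope c);
  chart_slope : {ae lebesgue_measure,
    forall a : R, is_derive a (1 : R) (graph c) (slope c a)}
}.

Definition has_lipschitz_boundary K : Prop :=
  forall x, bd K x -> exists2 c, is_lipschitz_chart K c & org c = x.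

Definition base (c : chart) : set R := [set a | `|a| < rad c].

(* [sigma] is the arc length on the boundary of K: on the graph part of every
   chart it is the image of sqrt (1 + graph'^2) da. *)
Definition is_arc_length K (sigma : set (plane R) -> \bar R) : Prop :=
  forall c, is_lipschitz_chart K c ->
  forall A : set (plane R), measurable A ->
    sigma (A `&` (graph_pt c @` base c)) =
    (\int[lebesgue_measure]_(a in base c)
       (\1_A (graph_pt c a) * Num.sqrt (1 + slope c a ^+ 2))%:E)%E.

(* (- graph', 1) / sqrt (1 + graph'^2) in the frame of the chart; it points out
   of K since K lies below the graph. *)
Definition graph_normal (c : chart) (a : R) : point R :=
  let l := Num.sqrt (1 + slope c a ^+ 2) in
  ((- slope c a * (dir c).1 - (dir c).2) / l,
   (- slope c a * (dir c).2 + (dir c).1) / l).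

Definition is_outward_normal K (n : point R -> point R) : Prop :=
  [/\ measurable_fun [set: plane R] (fun x : plane R => (n x).1 : R),
      measurable_fun [set: plane R] (fun x : plane R => (n x).2 : R) &
      forall c, is_lipschitz_chart K c ->
      {ae lebesgue_measure, forall a : R, base c a ->
         n (graph_pt c a) = graph_normal c a}].

End Geometry.

(* [arc] plays the role of the one-dimensional Hausdorff measure on the
   skeleton.  It is a single measure for all elements, so that the two sides of
   an interior face carry the same arc length.  [mesh_faces] says that up to
   arc length zero a point of the skeleton lies on at most one face, and a face
   belongs to at most two elements (three pairwise disjoint Lipschitz domains
   never share a set of positive arc length). *)
Record mesh (R : realType) := Mesh {
  dom : set (point R);
  nelt : nat;
  elt : 'I_nelt -> set (point R);
  arc : {measure set (plane R) -> \bar R};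
  normal : 'I_nelt -> point R -> point R;
  mesh_dom_open : open dom;
  mesh_dom_bounded : bounded_set dom;
  mesh_elt_open : forall i, open (elt i);
  mesh_elt_neq0 : forall i, elt i !=set0;
  mesh_elt_sub : forall i, elt i `<=` dom;
  mesh_elt_disj : forall i j, i != j -> elt i `&` elt j = set0;
  mesh_cover : closure dom = \bigcup_i closure (elt i);
  mesh_lipschitz : forall i, has_lipschitz_boundary (elt i);
  mesh_arc : forall i, is_arc_length (elt i) arc;
  mesh_normal : forall i, is_outward_normal (elt i) (normal i);
  mesh_faces : forall i j l, uniq [:: i; j; l] ->
    arc (bd (elt i) `&` bd (elt j) `&` bd (elt l)) = 0%E
}.

Section Polynomials.
Variable R : realType.

Definition poly2 := mpoly 2 R.

Definition ev (w : poly2) (x : point R) : R :=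
  meval (fun i : 'I_2 => if i == ord0 then x.1 else x.2) w.

Definition dx (w : poly2) : poly2 := mderiv ord0 w.
Definition dy (w : poly2) : poly2 := mderiv ord_max w.

(* Total degree at most p: [msize] is one more than the degree. *)
Definition Pdeg (p : nat) (w : poly2) : Prop := (mmeasure mdeg w <= p.+1)%N.

End Polynomials.

Section IHDG.
Variables (R : realType) (M : mesh R).

(* An element is a nonempty open set, so a polynomial on it is determined by
   its values there. *)
Record state := State {
  ph : 'I_(nelt M) -> poly2 R;
  uu : 'I_(nelt M) -> poly2 R;
  vv : 'I_(nelt M) -> poly2 R
}.

Definition state_deg (p : nat) (s : state) : Prop :=
  forall i, [/\ Pdeg p (ph s i), Pdeg p (uu s i) & Pdeg p (vv s i)].

Definition mesh_size : R :=
  \big[Num.max/0]_(i < nelt M) diam (elt (m := M) i).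

Definition ipK (i : 'I_(nelt M)) (g1 g2 : point R -> R) : R :=
  \int[area R]_(x in elt i) (g1 x * g2 x).

Definition ipdK (i : 'I_(nelt M)) (g1 g2 : point R -> R) : R :=
  \int[arc M]_(x in bd (elt i)) (g1 x * g2 x).

Definition nx (i : 'I_(nelt M)) (x : point R) : R := (normal i x).1.
Definition ny (i : 'I_(nelt M)) (x : point R) : R := (normal i x).2.

(* Exterior trace on the boundary of element i.  Interior faces are the sets
   bd K_i `&` bd K_j inside the domain; by [mesh_faces] the sum has at most one
   term almost everywhere. *)
Definition ext (i : 'I_(nelt M)) (w : 'I_(nelt M) -> point R -> R)
    (x : point R) : R :=
  if x \in dom M then
    \sum_(j < nelt M | (j != i) && (x \in bd (elt j))) w j x
  else 0.

Definition avg (i : 'I_(nelt M)) (w : 'I_(nelt M) -> point R -> R)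
    (x : point R) : R :=
  (w i x + ext i w x) / 2.

Definition normal_flux (s : state) (i : 'I_(nelt M)) (x : point R) : R :=
  ev (uu s i) x * nx i x + ev (vv s i) x * ny i x.

Definition phat (Phi : R) (s : state) (i : 'I_(nelt M)) (x : point R) : R :=
  avg i (fun j => ev (ph s j)) x + Num.sqrt Phi * avg i (normal_flux s) x.

Definition coriolis (f0 beta0 ym : R) (x : point R) : R :=
  f0 + beta0 * (x.2 - ym).

(* [s'] is obtained from [s] by one iHDG iteration on every element. *)
Definition ihdg_step (p : nat) (Phi gamma f0 beta0 ym dt : R)
    (s s' : state) : Prop :=
  forall i (q1 q2 q3 : poly2 R), Pdeg p q1 -> Pdeg p q2 -> Pdeg p q3 ->
  let f := coriolis f0 beta0 ym in
  let phi := ev (ph s' i) in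
  let u := ev (uu s' i) in
  let v := ev (vv s' i) in
  let hat := phat Phi s i in
  [/\ ipK i (fun x => phi x / dt) (ev q1)
      - (ipK i (fun x => Phi * u x) (ev (dx q1))
         + ipK i (fun x => Phi * v x) (ev (dy q1)))
      + ipdK i (fun x => Phi * normal_flux s' i x
                         + Num.sqrt Phi * (phi x - hat x)) (ev q1) = 0,
      ipK i (fun x => Phi * u x / dt) (ev q2)
      - ipK i (fun x => Phi * phi x) (ev (dx q2))
      + ipdK i (fun x => Phi * hat x * nx i x) (ev q2)
      = ipK i (fun x => f x * Phi * v x - gamma * Phi * u x) (ev q2)
    & ipK i (fun x => Phi * v x / dt) (ev q3)
      - ipK i (fun x => Phi * phi x) (ev (dy q3))
      + ipdK i (fun x => Phi * hat x * ny i x) (ev q3)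
      = ipK i (fun x => - f x * Phi * u x - gamma * Phi * v x) (ev q3)].

(* Squared norms; sqrt(Phi) theta has components sqrt(Phi) u, sqrt(Phi) v. *)
Definition sqnorm_dom (Phi : R) (s : state) : R :=
  \sum_(i < nelt M)
    (ipK i (ev (ph s i)) (ev (ph s i))
     + (ipK i (fun x => Num.sqrt Phi * ev (uu s i) x)
              (fun x => Num.sqrt Phi * ev (uu s i) x)
        + ipK i (fun x => Num.sqrt Phi * ev (vv s i) x)
                (fun x => Num.sqrt Phi * ev (vv s i) x))).

Definition sqnorm_skel (Phi : R) (s : state) : R :=
  \sum_(i < nelt M)
    (ipdK i (ev (ph s i)) (ev (ph s i))
     + (ipdK i (fun x => Num.sqrt Phi * ev (uu s i) x)
               (fun x => Num.sqrt Phi * ev (uu s i) x)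
        + ipdK i (fun x => Num.sqrt Phi * ev (vv s i) x)
                 (fun x => Num.sqrt Phi * ev (vv s i) x))).

(* 2 c h / (d (p+1) (p+2)) with space dimension d = 2. *)
Definition inverse_trace (p : nat) (c : R) : Prop :=
  forall i (w : poly2 R), Pdeg p w ->
    2 * c * mesh_size / (2 * (p.+1)%:R * (p.+2)%:R) * ipdK i (ev w) (ev w)
    <= ipK i (ev w) (ev w).

End IHDG.

(* Main.v *)
Require Import Defs.
From HB Require Import structures.
From mathcomp Require Import all_boot all_order all_algebra.
From mathcomp Require Import ring lra.
From mathcomp Require Import all_classical all_reals all_analysis.
From mathcomp Require Import measurable_realfun.
From mathcomp Require Import -(notations) mpoly.
Import Order.TTheory GRing.Theory Num.Theory numFieldNormedType.Exports.
Local Open Scope classical_set_scope.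
Local Open Scope ring_scope.
Import Defs.

(** The proof is an energy argument.  Testing the three equations on an element with
    the new iterate makes the Coriolis terms cancel, and Green's formula turns the
    coupling of height and velocity into boundary terms ([energy_identity]).  What
    remains is that the volume energy of the new iterate, plus a stabilisation term
    in its height, equals a boundary integral pairing the numerical trace of the old
    iterate with traces of the new one.  Young's inequality ([young_flux]) bounds that
    integral by A times the squared skeleton norm of the old iterate plus multiples of
    the squared traces of the new one; here one needs that the normal is a unit vector and that, up to arc length zero, a point of
    the skeleton belongs to at most two elements, so that the exterior traces summed
    over all elements are dominated by the interior ones ([sum_exterior_le]).  The
    inverse trace inequality absorbs the traces of the new iterate into the volume
    energy.  This gives B * |new|^2 <= A * |old|^2 on the skeleton, that is
    contraction by C, and putting this back into the energy estimate gives the bound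
    in the domain.

    The main ingredient is Green's formula on an element, that is the divergence
    theorem on a bounded Lipschitz domain K ([divergence_theorem]).  It is proved from
    difference quotients: for a fixed vector e,
      1/h * (the integral over K of F(x + h e) - F(x))
    tends to the integral of the derivative of F along e.  On the other hand, after a
    change of variable it is 1/h times the integral of F over the difference between
    K translated by h e and K.  Seen in a chart this difference is a thin slab
    between two Lipschitz graphs, whose thickness divided by h converges almost
    everywhere to the normal component of e times the length element
    ([cvg_chart_flux]).  The second description uses no derivative of F, so the
    passage from one chart to all of K only takes a continuous partition of unity
    ([flux_cvg_continuous]).  The area is invariant under the rigid motions that
    straighten the charts ([ge0_integral_frame]), and the abstract arc length is
    evaluated in a chart as a weighted image of the Lebesgue measure
    ([integral_weighted_image]). *)

Set Implicit Arguments.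
Unset Strict Implicit.
Unset Printing Implicit Defensive.

(** * Borel sets of the plane and affine changes of variable *)

Section Plane.
Variable R : realType.
Implicit Types (f : point R -> R).

(** The product sigma-algebra is generated by rectangles, and an open set is the
    countable union of the rational squares that it contains. *)
Lemma measurable_open_plane (U : set (point R)) :
  open U -> measurable (U : set (plane R)).
Proof.
move=> oU.
pose B (t : rat * rat * rat) : set (plane R) :=
  ball (ratr t.1.1 : R) (ratr t.2) `*` ball (ratr t.1.2 : R) (ratr t.2).
pose F t := if `[< B t `<=` U >] then B t else set0.
have -> : U = \bigcup_t F t.
  apply/seteqP; split => [[x y] Uxy|[x y] [t _]]; last first.
    by rewrite /F; case: asboolP => // BU; exact: BU.
  have /nbhs_ballP[e /= e0 beU] : nbhs (x, y) U by exact: open_nbhs_nbhs.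
  have [r r0 re] : exists2 r : rat, 0 < ratr r :> R & ratr r < (e / 2 : R).
    have [r] := rat_in_itvoo (divr_gt0 e0 (ltr0Sn R 1)).
    by rewrite in_itv/= => /andP[]; exists r.
  have rx (z : R) : exists q : rat, `|ratr q - z| < ratr r.
    have zr : z - ratr r < z + ratr r :> R by lra.
    have [q] := rat_in_itvoo zr.
    by rewrite in_itv/= => hq; exists q; rewrite ltr_norml; lra.
  have [q1 hq1] := rx x; have [q2 hq2] := rx y.
  exists (q1, q2, r) => //; rewrite /F asboolT; first by split.
  move=> [a b] [/= ha hb]; apply: beU; split => /=.
    move: hq1 ha; rewrite /ball/= !ltr_norml; lra.
  move: hq2 hb; rewrite /ball/= !ltr_norml; lra.
apply: countable_bigcupT_measurable => // t; rewrite /F; case: asboolP => // _.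
by apply: measurableX; exact: measurable_ball.
Qed.

Lemma continuous_measurable_plane f : continuous f ->
  measurable_fun [set: plane R] (f : plane R -> R).
Proof.
move=> /continuousP cf.
apply: (measurability (@RGenOInfty.G R)).
  exact: RGenOInfty.measurableE.
move=> _ [_ [r -> <-]]; rewrite setTI; apply: measurable_open_plane.
exact: cf.
Qed.

Local Notation leb := (@lebesgue_measure R).

Lemma measurable_affine (al be : R) :
  measurable_fun [set: measurableTypeR R]
    ((fun x => al * x + be) : measurableTypeR R -> measurableTypeR R).
Proof.
apply: continuous_measurable_fun => x; apply: cvgD; last exact: cvg_cst.
by apply: cvgM; [exact: cvg_cst|exact: cvg_id].
Qed.

(** By uniqueness of the Lebesgue measure it is enough to look at half-open
    intervals; a negative [al] turns them around, which costs the two cases. *)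
Lemma lebesgue_affine (al be : R) (A : set (measurableTypeR R)) : al != 0 ->
  measurable A ->
  leb A = (`|al|%:E * leb ((fun x => al * x + be)%R @^-1` A))%E.
Proof.
move=> al0 mA.
pose phi : measurableTypeR R -> measurableTypeR R := fun x => al * x + be.
have mphi : measurable_fun setT phi by exact: measurable_affine.
pose mphi_mixin := isMeasurableFun.Build _ _ _ _ _ mphi.
pose mphi_pack : {mfun _ >-> _} := HB.pack phi mphi_mixin.
pose k : {nonneg R} := NngNum (normr_ge0 al).
have := @lebesgue_measure_unique R (mscale k (pushforward leb mphi_pack)).
apply => // X /ocitvP[->|[[a b] /= ab ->]]; first by rewrite !measure0.
rewrite /mscale/= /pushforward/= lebesgue_measure_itv/= lte_fin ab.
have [alp|aln|/eqP] := ltgtP al 0; last by rewrite (negbTE al0).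
  have -> : phi @^-1` `]a, b] = `[(b - be) / al, (a - be) / al[%classic.
    apply/seteqP; split => x /=; rewrite /phi !in_itv/= ler_ndivrMr// ltr_ndivlMr//;
     rewrite [x * al]mulrC; lra.
  rewrite lebesgue_measure_itv/= lte_fin ltr_ndivrMr// divfK ?lt_eqF//.
  rewrite ltrD2r ab -EFinD -EFinM ltr0_norm//; congr EFin.
  by rewrite -!mulrBl mulrCA mulNr; field.
have -> : phi @^-1` `]a, b] = `](a - be) / al, (b - be) / al]%classic.
  apply/seteqP; split => x /=; rewrite /phi !in_itv/= ltr_pdivrMr// ler_pdivlMr//;
   rewrite [x * al]mulrC; lra.
rewrite lebesgue_measure_itv/= lte_fin ltr_pdivrMr// divfK ?gt_eqF//.
rewrite ltrD2r ab -EFinD -EFinM gtr0_norm//; congr EFin.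
by rewrite -!mulrBl; field.
Qed.

Local Open Scope ereal_scope.

Lemma ge0_integral_affine (al be : R) (f : measurableTypeR R -> \bar R) :
  al != 0%R -> measurable_fun setT f -> (forall x, 0 <= f x) ->
  \int[leb]_x f x = `|al|%:E * \int[leb]_x f (al * x + be)%R.
Proof.
move=> al0 mf f0.
have mphi := measurable_affine al be.
pose mphi_mixin := isMeasurableFun.Build _ _ _ _ _ mphi.
pose mphi_pack : {mfun _ >-> _} := HB.pack
  ((fun x => al * x + be)%R : measurableTypeR R -> measurableTypeR R) mphi_mixin.
pose k : {nonneg R} := NngNum (normr_ge0 al).
rewrite (@eq_measure_integral _ _ _ setT (mscale k (pushforward leb mphi_pack))).
  rewrite ge0_integral_mscale//; congr (_ * _).
  by rewrite ge0_integral_pushforward// => x _; exact: f0.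
move=> A mA _; exact: lebesgue_affine.
Qed.

End Plane.

(** * Invariance of the area under rigid motions *)

Section Frame.
Variable R : realType.
Local Notation leb := (@lebesgue_measure R).

Lemma measurable_affine_plane (p q r p' q' r' : R) :
  measurable_fun [set: plane R]
    ((fun z => (p + q * z.1 + r * z.2, p' + q' * z.1 + r' * z.2)) :
       plane R -> plane R).
Proof.
by apply: measurable_fun_pair; apply: continuous_measurable_plane => z;
  (apply: cvgD; [apply: cvgD|]; [exact: cvg_cst|
    apply: cvgM; [exact: cvg_cst|exact: cvg_fst]|
    apply: cvgM; [exact: cvg_cst|exact: cvg_snd]]).
Qed.

Local Open Scope ereal_scope.

Lemma ge0_integral_affine_inv (al be : R) (f : measurableTypeR R -> \bar R) :
  al != 0%R -> measurable_fun setT f -> (forall x, 0 <= f x) ->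
  \int[leb]_x f (al * x + be)%R = (`|al|^-1)%:E * \int[leb]_x f x.
Proof.
move=> al0 mf f0; rewrite [in RHS](@ge0_integral_affine _ al be)// muleA -EFinM mulVf ?mul1e//.
by rewrite normr_eq0.
Qed.

(** A rotation whose first entry [d1] is nonzero is a composition of two affine
    changes of one variable at a time, with Jacobians [d1] and [1 / d1], so
    Tonelli's theorem reduces the claim to dimension one.  If [d1 = 0], the frame
    only exchanges the coordinates, up to signs and translations. *)
Lemma ge0_integral_frame (c : chart R) (f : plane R -> \bar R) :
  ((dir c).1 ^+ 2 + (dir c).2 ^+ 2 = 1)%R ->
  measurable_fun setT f -> (forall x, 0 <= f x) ->
  \int[area R]_z f z = \int[area R]_z f (frame c z.1 z.2).
Proof.
case: c => [[p1 p2] [d1 d2] rd ht g sl] /= d1d2 mf f0.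
rewrite /frame/=.
have mfa p q r p' q' r' : measurable_fun [set: plane R]
    (fun z : plane R => f (p + q * z.1 + r * z.2, p' + q' * z.1 + r' * z.2)%R).
  exact: (measurableT_comp mf (measurable_affine_plane _ _ _ _ _ _)).
have [d10|d10] := eqVneq d1 0%R.
  have d20 : d2 != 0%R.
    by apply: contra_eq_neq d1d2 => ->; rewrite d10 expr0n addr0 eq_sym oner_neq0.
  have nd2 : (`|d2| = 1)%R.
    by apply/eqP; rewrite -(@pexpr_eq1 _ _ 2)// real_normK ?num_real// -d1d2 d10 expr0n add0r.
  rewrite [LHS](fubini_tonelli2 f)// [RHS]fubini_tonelli1//; last first.
    have := mfa p1 0%R (- d2)%R p2 d2 0%R; apply: eq_measurable_fun => z _.
    by congr (f (_, _)); rewrite ?d10; ring.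
  rewrite /fubini_F /fubini_G/=.
  rewrite (@ge0_integral_affine _ d2 p2)//; first last.
  - by move=> x; apply: integral_ge0.
  - exact: measurable_fun_fubini_tonelli_G.
  rewrite nd2 mul1e; apply: eq_integral => a _.
  rewrite (@ge0_integral_affine _ (- d2) p1) ?oppr_eq0//; last first.
    exact: measurable_fun_pair1.
  rewrite normrN nd2 mul1e; apply: eq_integral => b _.
  by congr (f (_, _)); rewrite ?d10; ring.
rewrite [RHS]fubini_tonelli2//; last first.
  have := mfa p1 d1 (- d2)%R p2 d2 d1; apply: eq_measurable_fun => z _.
  by congr (f (_, _)); ring.
rewrite /fubini_G/=.
(* F (x, b) is f at the point with first coordinate x on the line where the second
   frame coordinate is b: the frame coordinate a has been eliminated in favour of x. *)
pose F (z : plane R) := f (z.1, p2 - d2 / d1 * p1 + d2 / d1 * z.1 + d1^-1 * z.2)%R.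
have mF : measurable_fun setT F.
  have := mfa 0%R 1%R 0%R (p2 - d2 / d1 * p1)%R (d2 / d1)%R (d1^-1)%R.
  apply: eq_measurable_fun => z _.
  by congr (f (_, _)); ring.
have F0 z : 0 <= F z by exact: f0.
transitivity (\int[leb]_b ((`|d1|^-1)%:E * \int[leb]_x F (x, b))); last first.
  apply: eq_integral => b _.
  rewrite -(@ge0_integral_affine_inv d1 (p1 - b * d2)%R (fun x => F (x, b)))//; last first.
    exact: (measurable_fun_pair1 b mF).
  apply: eq_integral => a _; rewrite /F/=; congr (f (_, _)); first by ring.
  (* This is where the frame has to be orthonormal. *)
  have e : (d1^-1 = d1 + d2 ^+ 2 / d1)%R by rewrite -[LHS]mul1r -d1d2; field.
  by rewrite [X in (_ + X * b)%R]e; field.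
rewrite ge0_integralZl//; first last.
- by move=> x _; exact: integral_ge0.
- exact: measurable_fun_fubini_tonelli_G.
rewrite -[X in _ = _ * X]fubini_tonelli// fubini_tonelli1// -ge0_integralZl//; first last.
- by move=> x _; exact: integral_ge0.
- exact: measurable_fun_fubini_tonelli_F.
apply: eq_integral => x _; rewrite /fubini_F /F /=.
under [in RHS]eq_integral => y _ do rewrite addrC.
rewrite (@ge0_integral_affine_inv _ _ (fun y => f (x, y))) ?invr_eq0//; last first.
  exact: measurable_fun_pair2.
by rewrite normfV invrK muleA -EFinM mulVf ?mul1e// normr_eq0.
Qed.

End Frame.

(** * Bounded functions on sets of finite measure *)

Section BoundedIntegrable.
Context d (T : measurableType d) (R : realType) (mu : {measure set T -> \bar R}).

Lemma integrable_bounded (D : set T) (f : T -> R) : measurable D ->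
  (mu D < +oo)%E -> measurable_fun [set: T] f ->
  (exists C, forall x, D x -> `|f x| <= C) -> mu.-integrable D (EFin \o f).
Proof.
move=> mD Dfin mf [C fC]; apply: measurable_bounded_integrable => //.
  exact: measurable_funTS.
exists C; split; first exact: num_real.
by move=> y Cy x Dx; exact: le_trans (fC _ Dx) (ltW Cy).
Qed.

Lemma integrable_bounded_support (D : set T) (f : T -> R) : measurable D ->
  (mu D < +oo)%E -> measurable_fun [set: T] f ->
  (exists C, forall x, `|f x| <= C) -> (forall x, ~ D x -> f x = 0) ->
  mu.-integrable [set: T] (EFin \o f).
Proof.
move=> mD Dfin mf [C fC] f0.
have -> : EFin \o f = (EFin \o f) \_ D.
  apply/funext => x; rewrite patchE /=; case: ifPn => // /negP xD.
  by rewrite f0// => Dx; apply: xD; exact/mem_set.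
apply: (integrable_mkcond (EFin \o f) mD).1.
by apply: integrable_bounded => //; exists C => x _; exact: fC.
Qed.

End BoundedIntegrable.

(** * The mass of a thin slab *)

Section StepDifference.
Variable R : realType.
Local Notation leb := (@lebesgue_measure R).
Implicit Types u v b : R.

(** The signed indicator of the interval between [u] and [v]: the difference made,
    on one vertical line, by moving the upper end of the region below a graph. *)
Definition step_diff u v b : R := (b < u)%R%:R - (b < v)%R%:R.

Lemma step_diffE u v b : step_diff u v b = \1_(`[v, u[) b - \1_(`[u, v[) b.
Proof.
rewrite /step_diff !indicE !mem_setE !in_itv/=.
by case: (ltP b u) => h1; case: (ltP b v) => h2; rewrite ?andbF ?andbT//= ?subrr ?subr0 ?sub0r.
Qed.

Lemma normr_step_diffE u v b :
  `|step_diff u v b| = \1_(`[v, u[) b + \1_(`[u, v[) b.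
Proof.
rewrite /step_diff !indicE !mem_setE !in_itv/=.
by case: (ltP b u) => h1; case: (ltP b v) => h2; rewrite ?andbF ?andbT//= ?subrr
  ?subr0 ?sub0r ?normrN ?normr0 ?normr1 ?addr0 ?add0r.
Qed.

Lemma step_diff_support u v b : step_diff u v b != 0 -> `|b - v| <= `|u - v|.
Proof.
rewrite /step_diff; case: (ltP b u) => h1; case: (ltP b v) => h2; rewrite ?subrr ?eqxx// => _.
  by rewrite !ger0_norm; lra.
by rewrite !ltr0_norm; lra.
Qed.

Lemma measurable_step_diff u v :
  measurable_fun [set: measurableTypeR R] (step_diff u v : measurableTypeR R -> R).
Proof.
rewrite (_ : step_diff u v = \1_(`[v, u[) \- \1_(`[u, v[)); last first.
  by apply/funext => b; rewrite step_diffE.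
by apply: measurable_funB; exact: measurable_indic.
Qed.

Let integrable_itv u v :
  leb.-integrable setT (EFin \o (\1_(`[v, u[) : measurableTypeR R -> R)).
Proof. exact: integrable_indic_itv. Qed.

Let Rintegral_itv u v : \int[leb]_x \1_(`[v, u[) x = Num.max 0 (u - v).
Proof.
rewrite /Rintegral integral_indic// setIT [X in fine X]lebesgue_measure_itv/= lte_fin.
case: ifPn => [uv|]; last by rewrite -leNgt => uv; apply/esym/max_idPl; rewrite subr_le0.
by apply/esym/max_idPr; rewrite subr_ge0 ltW.
Qed.

Lemma integrable_step_diff u v :
  leb.-integrable setT (EFin \o (step_diff u v : measurableTypeR R -> R)).
Proof.
rewrite (_ : EFin \o _ =
  (fun x => (EFin \o \1_(`[v, u[)) x - (EFin \o \1_(`[u, v[)) x)%E); last first.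
  by apply/funext => b; rewrite /= step_diffE EFinB.
exact: integrableB.
Qed.

Lemma Rintegral_step_diff u v : \int[leb]_b step_diff u v b = u - v.
Proof.
under eq_Rintegral do rewrite step_diffE.
rewrite RintegralB// !Rintegral_itv.
by rewrite /Num.max; case: ifPn; case: ifPn; lra.
Qed.

Lemma Rintegral_normr_step_diff u v : \int[leb]_b `|step_diff u v b| = `|u - v|.
Proof.
under eq_Rintegral do rewrite normr_step_diffE.
rewrite RintegralD// !Rintegral_itv.
by rewrite /Num.max; case: ifPn; case: ifPn; case: (ger0P (u - v)); lra.
Qed.

Lemma measurable_step_diffM u v (f : R -> R) : continuous f ->
  measurable_fun [set: measurableTypeR R]
    ((fun b => step_diff u v b * f b) : measurableTypeR R -> R).
Proof.
move=> cf; apply: measurable_funM; first exact: measurable_step_diff.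
exact: continuous_measurable_fun.
Qed.

Lemma integrable_step_diffM u v (f : R -> R) C : continuous f ->
  (forall b, `|f b| <= C) ->
  leb.-integrable setT (EFin \o (fun b => step_diff u v b * f b : R)).
Proof.
move=> cf fC; pose g : measurableTypeR R -> \bar R := fun b => (C * step_diff u v b)%:E.
apply: (@le_integrable _ _ _ leb setT measurableT _ g).
- by apply/measurable_EFinP; exact: measurable_step_diffM.
- move=> b _; rewrite /= lee_fin !normrM mulrC ler_wpM2r//.
  by rewrite (le_trans (fC b))// ler_norm.
- have := integrableZl measurableT C (integrable_step_diff u v).
  by apply: eq_integrable => // b _; rewrite /= EFinM.
Qed.

(** Uniform in the position of the slab: this gives the dominating function when
    the slabs over all base points are integrated. *)
Lemma Rintegral_step_diff_le u v (f : R -> R) C : continuous f ->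
  (forall b, `|f b| <= C) ->
  `|\int[leb]_b (step_diff u v b * f b)| <= C * `|u - v|.
Proof.
move=> cf fC.
have C0 : 0 <= C by rewrite (le_trans _ (fC 0)).
have i1 := integrable_step_diffM u v cf fC.
have i2 : leb.-integrable setT (EFin \o (fun b => `|step_diff u v b| : R)).
  exact: integrable_norm (integrable_step_diff u v).
apply: (le_trans (le_normr_Rintegral measurableT i1)).
rewrite -(Rintegral_normr_step_diff u v) -RintegralZl//.
apply: le_Rintegral => //.
- exact: integrable_norm i1.
- have := integrableZl measurableT C i2.
  by apply: eq_integrable => // b _; rewrite /= EFinM.
- by move=> b _; rewrite normrM mulrC ler_wpM2r.
Qed.

(** The slab has signed thickness [h n * w n], and by continuity [f] is uniformly
    close to [f v] on it, so its mass is [h n * w n * f v] up to [o(h n)]. *)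
Lemma cvg_step_diff (f : R -> R) C (v q : R) (h w : R^nat) : continuous f ->
  (forall b, `|f b| <= C) -> (forall n, 0 < h n) -> h @ \oo --> 0 ->
  w @ \oo --> q ->
  (fun n => (h n)^-1 * \int[leb]_b (step_diff (v + h n * w n) v b * f b)) @ \oo
    --> q * f v.
Proof.
move=> cf fC h0 hcvg wcvg.
have wf : (fun n => w n * f v) @ \oo --> q * f v by apply: cvgM => //; exact: cvg_cst.
set F := (F in F @ \oo --> _).
suff d0 : (F \- (fun n => w n * f v)) @ \oo --> 0.
  have Fcvg := cvgD d0 wf; rewrite add0r in Fcvg.
  have -> : F = (F \- (fun n => w n * f v)) \+ (fun n => w n * f v).
    by apply/funext => n /=; rewrite subrK.
  exact: Fcvg.
apply/cvgrPdist_le => e e0.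
have q1 : 0 < `|q| + 1 by rewrite ltr_pwDr.
have e'0 : 0 < e / (`|q| + 1) by rewrite divr_gt0.
have := (@cvgrPdist_le _ _ _ (nbhs v) _ f (f v)).1 (cf v) _ e'0.
move=> [del /= del0 fdel].
have hw : (fun n => h n * w n) @ \oo --> 0.
  by rewrite -(mul0r q); apply: cvgM.
have wb : \forall n \near \oo, `|w n| <= `|q| + 1.
  move/cvgrPdist_le : wcvg => /(_ _ ltr01); apply: filterS => n.
  rewrite distrC => wn; rewrite -(subrK q (w n)) (le_trans (ler_normD _ _))//.
  by rewrite addrC lerD2l.
move/cvgrPdist_lt : hw => /(_ _ del0) hw.
near=> n.
have hwn : `|h n * w n| < del.
  by near: n; apply: filterS hw => n; rewrite sub0r normrN.
have wn : `|w n| <= `|q| + 1 by near: n.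
set u := v + h n * w n.
have uv : u - v = h n * w n by rewrite /u addrC addKr.
have i1 := integrable_step_diffM u v cf fC.
have i2 : leb.-integrable setT (EFin \o (fun b => step_diff u v b * f v : R)).
  have := integrableZl measurableT (f v) (integrable_step_diff u v).
  by apply: eq_integrable => // b _; rewrite /= -EFinM mulrC.
rewrite sub0r normrN /= /F -/u.
have -> : w n * f v = (h n)^-1 * \int[leb]_b (step_diff u v b * f v).
  rewrite RintegralZr//; last exact: integrable_step_diff.
  by rewrite Rintegral_step_diff uv mulrA mulKf// gt_eqF.
rewrite -mulrBr -RintegralB//.
rewrite normrM gtr0_norm ?invr_gt0// ler_pdivrMl//.
have i3 : leb.-integrable setT
    (EFin \o (fun b => step_diff u v b * f b - step_diff u v b * f v : R)).
  have := integrableB measurableT i1 i2.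
  by apply: eq_integrable => // b _; rewrite /= EFinB.
apply: (le_trans (le_normr_Rintegral measurableT i3)).
apply: (@le_trans _ _ (e / (`|q| + 1) * `|u - v|)).
  have i4 : leb.-integrable setT (EFin \o (fun b => `|step_diff u v b| : R)).
    exact: integrable_norm (integrable_step_diff u v).
  rewrite -(Rintegral_normr_step_diff u v) -RintegralZl//.
  apply: le_Rintegral => //.
  - exact: integrable_norm i3.
  - have := integrableZl measurableT (e / (`|q| + 1)) i4.
    by apply: eq_integrable => // b _; rewrite /= EFinM.
  - move=> b _; rewrite -mulrBr normrM.
    have [->|nz] := eqVneq (step_diff u v b) 0; first by rewrite normr0 mul0r mulr0.
    rewrite mulrC ler_wpM2r// distrC; apply: fdel; rewrite /ball/= distrC.
    by rewrite (le_lt_trans (step_diff_support nz))// uv.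
rewrite uv normrM (gtr0_norm (h0 n)) mulrCA ler_pM2l//.
by rewrite -mulrA ler_piMr ?(ltW e0)// mulrC ler_pdivrMr// mul1r.
Unshelve. all: by end_near.
Qed.

End StepDifference.

(** * Integration against a weighted image measure *)

Section WeightedImage.
Local Open Scope ereal_scope.
Context d1 d2 (X : measurableType d1) (Y : measurableType d2) (R : realType).
Variables (mu : {measure set X -> \bar R}) (sigma : {measure set Y -> \bar R}).
Variables (D : set X) (G : set Y) (phi : X -> Y) (w : X -> R).
Hypotheses (mD : measurable D) (mG : measurable G).
Hypotheses (mphi : measurable_fun setT phi) (mw : measurable_fun setT w).
Hypothesis w0 : forall x, (0 <= w x)%R.
Hypothesis sigmaE : forall A, measurable A ->
  sigma (A `&` G) = \int[mu]_(x in D) (\1_A (phi x) * w x)%:E.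

Import HBNNSimple.

(** The hypothesis on sets is the claim for indicators; linearity extends it to
    simple functions and monotone convergence to all nonnegative ones. *)
Lemma ge0_integral_weighted_image (f : Y -> \bar R) :
  measurable_fun setT f -> (forall y, 0 <= f y) ->
  \int[sigma]_(y in G) f y = \int[mu]_(x in D) (f (phi x) * (w x)%:E).
Proof.
move=> mf f0.
pose f_ := nnsfun_approx measurableT mf.
have mfphi n : measurable_fun setT (f_ n \o phi).
  by apply: measurableT_comp.
have mind (A : set Y) : measurable A -> measurable_fun setT (\1_A \o phi : X -> R).
  by move=> mA; apply: measurableT_comp.
transitivity (limn (fun n => \int[sigma]_(y in G) (f_ n y)%:E)).
  rewrite -monotone_convergence//.
  - apply: eq_integral => y _; apply/esym/cvg_lim => //.
    by apply: cvg_nnsfun_approx.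
  - by move=> n; exact/measurable_funTS/measurable_EFinP.
  - by move=> n y _; rewrite lee_fin.
  - by move=> y _ m n mn; rewrite lee_fin; exact/lefP/nd_nnsfun_approx.
rewrite [X in limn X](_ : _ =
    (fun n => \int[mu]_(x in D) (f_ n (phi x) * w x)%:E)).
  rewrite -monotone_convergence//; last 3 first.
  - move=> n; apply/measurable_funTS/measurable_EFinP.
    by apply: measurable_funM => //; exact: mfphi.
  - by move=> n x _; rewrite lee_fin mulr_ge0.
  - move=> x _ m n mn; rewrite lee_fin ler_wpM2r//.
    exact/lefP/nd_nnsfun_approx.
  apply: eq_integral => x _; apply/cvg_lim => //.
  under eq_fun do rewrite EFinM.
  by apply: cvgeZr => //; exact: cvg_nnsfun_approx.
apply/funext => n.
transitivity (\sum_(k \in range (f_ n))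
    \int[mu]_(x in D) (k * (\1_(f_ n @^-1` [set k]) (phi x) * w x))%:E).
  under eq_integral do rewrite fimfunE -fsumEFin//.
  rewrite ge0_integral_fsum//; last 2 first.
  - by move=> y; apply/measurable_funTS/measurable_EFinP/measurable_funM.
  - by move=> y x _; rewrite nnfun_muleindic_ge0.
  apply: eq_fsbigr => r; rewrite inE => -[y0 _ <-{r}].
  under eq_integral do rewrite EFinM.
  under [RHS]eq_integral do rewrite EFinM.
  rewrite !ge0_integralZl//; last 5 first.
  - apply/measurable_funTS/measurable_EFinP/measurable_funM => //.
    by apply: mind.
  - by move=> x _; rewrite lee_fin mulr_ge0.
  - by rewrite lee_fin.
  - by apply/measurable_funTS/measurable_EFinP.
  - by rewrite lee_fin.
  by rewrite integral_indic// sigmaE.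
rewrite -ge0_integral_fsum//.
- apply: eq_integral => x _; rewrite fsumEFin//; congr EFin.
  rewrite fimfunE mulr_fsuml.
  by apply: eq_fsbigr => k _; rewrite mulrA.
- move=> r; apply/measurable_funTS/measurable_EFinP.
  apply: measurable_funM => //; apply: measurable_funM => //.
  exact: mind.
- move=> r x _; rewrite mulrA EFinM mule_ge0 ?lee_fin//.
  by have := nnfun_muleindic_ge0 (f_ n) r (phi x).
Qed.

Lemma integral_weighted_image (f : Y -> R) : measurable_fun setT f ->
  \int[sigma]_(y in G) (f y)%:E = \int[mu]_(x in D) (f (phi x) * w x)%:E.
Proof.
move=> mf; rewrite integralE [RHS]integralE.
have mEf : measurable_fun setT (EFin \o f) by exact/measurable_EFinP.
rewrite !ge0_integral_weighted_image//; first last.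
- exact: measurable_funepos.
- exact: measurable_funeneg.
congr (_ - _); apply: eq_integral => x _.
- rewrite !funeposE/=; case: (leP 0%R (f (phi x))) => fx.
    have fw : (0 <= f (phi x) * w x)%R by rewrite mulr_ge0.
    by rewrite !max_l ?lee_fin.
  have fw : (f (phi x) * w x <= 0)%R by rewrite mulr_le0_ge0// ltW.
  by rewrite !max_r ?mul0e ?lee_fin// ltW.
- rewrite !funenegE/=; case: (leP 0%R (f (phi x))) => fx.
    have fw : (0 <= f (phi x) * w x)%R by rewrite mulr_ge0.
    by rewrite !max_r ?mul0e// lee_fin oppr_le0.
  have fw : (f (phi x) * w x <= 0)%R by rewrite mulr_le0_ge0// ltW.
  rewrite !max_l; [by rewrite -EFinM mulNr|..];
    by rewrite lee_fin oppr_ge0// ltW.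
Qed.

End WeightedImage.

(** * Geometry of a Lipschitz chart *)

Section ChartGeometry.
Variable R : realType.
Implicit Types (c : chart R) (K : set (point R)) (x : point R).

Lemma unit_le1 (d d' : R) : d ^+ 2 + d' ^+ 2 = 1 -> `|d| <= 1.
Proof.
move=> dd; rewrite -(@ler_pXn2r _ 2) ?nnegrE// real_normK ?num_real// expr1n -dd.
by rewrite lerDl sqr_ge0.
Qed.

(** [tang] and [nrml] are the coordinates inverse to [frame]. *)
Definition tang c x : R :=
  (x.1 - (org c).1) * (dir c).1 + (x.2 - (org c).2) * (dir c).2.

Definition nrml c x : R :=
  (x.2 - (org c).2) * (dir c).1 - (x.1 - (org c).1) * (dir c).2.

Lemma frame_coords c x : (dir c).1 ^+ 2 + (dir c).2 ^+ 2 = 1 ->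
  frame c (tang c x) (nrml c x) = x.
Proof.
case: x => x1 x2 d1; rewrite /frame /tang /nrml/=; congr (_, _).
  by rewrite -[RHS](subrK (org c).1) -[x1 - _ in RHS]mulr1 -d1; ring.
by rewrite -[RHS](subrK (org c).2) -[x2 - _ in RHS]mulr1 -d1; ring.
Qed.

Lemma tang_frame c a b : (dir c).1 ^+ 2 + (dir c).2 ^+ 2 = 1 ->
  tang c (frame c a b) = a.
Proof. by move=> d1; rewrite /frame /tang/= -[RHS]mulr1 -d1; ring. Qed.

Lemma nrml_frame c a b : (dir c).1 ^+ 2 + (dir c).2 ^+ 2 = 1 ->
  nrml c (frame c a b) = b.
Proof. by move=> d1; rewrite /frame /nrml/= -[RHS]mulr1 -d1; ring. Qed.

(** A translation of the plane is a translation of the frame coordinates. *)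
Lemma frame_shift c a b e1 e2 t : (dir c).1 ^+ 2 + (dir c).2 ^+ 2 = 1 ->
  frame c (a + t * (e1 * (dir c).1 + e2 * (dir c).2))
          (b + t * (e2 * (dir c).1 - e1 * (dir c).2)) =
  ((frame c a b).1 + t * e1, (frame c a b).2 + t * e2).
Proof.
move=> d1; rewrite /frame/=; congr (_, _).
  by rewrite -[in RHS](mulr1 e1) -d1; ring.
by rewrite -[in RHS](mulr1 e2) -d1; ring.
Qed.

Lemma continuous_pair (T : topologicalType) (f g : T -> R) :
  continuous f -> continuous g -> continuous (fun z => (f z, g z) : point R).
Proof.
move=> cf cg z.
exact: (@cvg_pair _ _ _ (nbhs z) (nbhs (f z)) (nbhs (g z)) _ _ _ f g (cf z) (cg z)).
Qed.

Lemma near_norm_lt (T : topologicalType) (f : T -> R) (x : T) (r : R) :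
  {for x, continuous f} -> `|f x| < r -> \forall z \near x, `|f z| < r.
Proof. by move=> cf fxr; exact: (@cvgr_norm_lt R R T (nbhs x) _ f (f x) cf r fxr). Qed.

Lemma near_gt (T : topologicalType) (f : T -> R) (x : T) (r : R) :
  {for x, continuous f} -> r < f x -> \forall z \near x, r < f z.
Proof. by move=> cf fxr; exact: (@cvgr_gt R T (nbhs x) _ f (f x) cf r fxr). Qed.

Lemma continuous_affine (p q r : R) :
  continuous (fun x : point R => p + q * x.1 + r * x.2).
Proof.
by move=> z; (apply: cvgD; [apply: cvgD|]; [exact: cvg_cst|
    apply: cvgM; [exact: cvg_cst|exact: cvg_fst]|
    apply: cvgM; [exact: cvg_cst|exact: cvg_snd]]).
Qed.

Lemma continuous_tang c : continuous (tang c).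
Proof.
have -> : tang c = fun x =>
    (- (org c).1 * (dir c).1 - (org c).2 * (dir c).2)
    + (dir c).1 * x.1 + (dir c).2 * x.2.
  by apply/funext => x; rewrite /tang; ring.
exact: continuous_affine.
Qed.

Lemma continuous_nrml c : continuous (nrml c).
Proof.
have -> : nrml c = fun x =>
    (- (org c).2 * (dir c).1 + (org c).1 * (dir c).2)
    + (- (dir c).2) * x.1 + (dir c).1 * x.2.
  by apply/funext => x; rewrite /nrml; ring.
exact: continuous_affine.
Qed.

Lemma continuous_frame c : continuous (fun z : point R => frame c z.1 z.2).
Proof.
rewrite /frame; apply: continuous_pair.
  have -> : (fun z : point R => (org c).1 + z.1 * (dir c).1 - z.2 * (dir c).2) =
            (fun z => (org c).1 + (dir c).1 * z.1 + (- (dir c).2) * z.2).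
    by apply/funext => x; ring.
  exact: continuous_affine.
have -> : (fun z : point R => (org c).2 + z.1 * (dir c).2 + z.2 * (dir c).1) =
            (fun z => (org c).2 + (dir c).2 * z.1 + (dir c).1 * z.2).
  by apply/funext => x; ring.
exact: continuous_affine.
Qed.

Lemma lipschitz_bound (g : R -> R) : (exists L, L.-lipschitz g) ->
  exists2 L, 0 <= L & forall a a', `|g a - g a'| <= L * `|a - a'|.
Proof.
move=> [L gL]; exists (Num.max 0 L); first by rewrite le_max lexx.
move=> a a'; have := gL (a, a') (conj I I); move/le_trans; apply.
by rewrite ler_wpM2r// le_max lexx orbT.
Qed.

Lemma lipschitz_bound_continuous (g : R -> R) L :
  (forall a a', `|g a - g a'| <= L * `|a - a'|) -> continuous g.
Proof.
move=> gL a; apply/cvgrPdist_le => e e0.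
have L1 : 0 < `|L| + 1 by rewrite ltr_pwDr.
near=> b; rewrite (le_trans (gL _ _))//.
rewrite (@le_trans _ _ ((`|L| + 1) * `|a - b|))//.
  by rewrite ler_wpM2r// (le_trans (ler_norm _))// lerDl.
rewrite mulrC -ler_pdivlMr//; near: b.
by apply: cvgr_dist_le => //; rewrite divr_gt0.
Unshelve. all: by end_near. Qed.

Variables (K : set (point R)) (c : chart R).
Hypotheses (oK : open K) (Kc : is_lipschitz_chart K c).

Lemma continuous_chart_graph : continuous (graph c).
Proof.
have [L _ gL] := lipschitz_bound (chart_graph Kc).
exact: lipschitz_bound_continuous gL.
Qed.

Lemma continuous_graph_pt : continuous (graph_pt c).
Proof.
move=> a.
apply: (@continuous_comp _ _ _ (fun a => (a, graph c a) : point R)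
  (fun z => frame c z.1 z.2)); last exact: continuous_frame.
by apply: continuous_pair; [move=> ?; exact: cvg_id|exact: continuous_chart_graph].
Qed.

(** Below the graph the box lies in the open set K, above the graph a neighbourhood
    misses K, and a point of the graph is approached by the points of K below it. *)
Lemma chart_boundary a b : `|a| < rad c -> `|b| < hgt c ->
  bd K (frame c a b) <-> b = graph c a.
Proof.
move=> ar bh; have d1 := chart_dir Kc.
have sub := chart_subgraph Kc ar bh; split=> [[clK intK]|bE].
  apply/eqP; rewrite eq_le; apply/andP; split; last first.
    rewrite leNgt; apply/negP => /sub Kx; apply: intK.
    exact: open_nbhs_nbhs (conj oK Kx).
  rewrite leNgt; apply/negP => gb.
  set x := frame c a b in clK intK *.
  have tx : tang c x = a by exact: tang_frame.
  have nx : nrml c x = b by exact: nrml_frame.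
  have near1 : \forall z \near x, `|tang c z| < rad c.
    by apply: near_norm_lt; [exact: continuous_tang|rewrite tx].
  have near2 : \forall z \near x, `|nrml c z| < hgt c.
    by apply: near_norm_lt; [exact: continuous_nrml|rewrite nx].
  have near3 : \forall z \near x, 0 < nrml c z - graph c (tang c z).
    apply: (near_gt (f := fun z => nrml c z - graph c (tang c z))).
      apply: cvgB; first exact: continuous_nrml.
      apply: (continuous_comp (f := tang c)); first exact: continuous_tang.
      exact: continuous_chart_graph.
    by rewrite nx tx subr_gt0.
  have [z [Kz [z1 [z2 z3]]]] := clK _ (filterI near1 (filterI near2 near3)).
  have [] := chart_subgraph Kc z1 z2; rewrite frame_coords// => /(_ Kz).
  by move: z3; rewrite subr_gt0 => /lt_trans h /h; rewrite ltxx.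
have nK : ~ K (frame c a b) by move=> /sub; rewrite bE ltxx.
split; last by move=> /interior_subset.
move=> B nB.
have : \forall b' \near b, B (frame c a b') /\ `|b'| < hgt c.
  apply: filterI; last first.
    by apply: (near_norm_lt (f := id)) => //; exact: cvg_id.
  have : continuous (fun b => frame c a b).
    move=> b1; apply: (@continuous_comp _ _ _ (fun b => (a, b) : point R)
      (fun z => frame c z.1 z.2)); last exact: continuous_frame.
    by apply: continuous_pair => ?; [exact: cvg_cst|exact: cvg_id].
  by move=> /(_ b); apply.
move=> [e /= e0 be].
have [|Bb bh'] := be (b - e / 2).
  by rewrite /ball/= opprB addrC subrK gtr0_norm ?divr_gt0// ltr_pdivrMr// ltr_pMr// ltr1n.
exists (frame c a (b - e / 2)); split => //.
by apply/(chart_subgraph Kc ar bh'); rewrite -bE; rewrite ltrBlDr ltrDl divr_gt0.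
Qed.

Lemma graph_pt_boundary : graph_pt c @` base c `<=` bd K.
Proof.
move=> _ [a ar <-]; apply/chart_boundary => //.
exact: chart_in_box Kc _ ar.
Qed.

Lemma boundary_graph_pt x : `|tang c x| < rad c -> `|nrml c x| < hgt c ->
  bd K x -> (graph_pt c @` base c) x.
Proof.
move=> tx nx; rewrite -{1}(frame_coords x (chart_dir Kc)).
move=> /(chart_boundary tx nx) E; exists (tang c x) => //.
by rewrite /graph_pt -E; exact: frame_coords (chart_dir Kc).
Qed.

Lemma measurable_bd (A : set (point R)) : open A ->
  measurable (bd A : set (plane R)).
Proof.
move=> oA; rewrite /bd; apply: measurableD.
  rewrite -(setCK (closure A)); apply: measurableC.
  apply: measurable_open_plane; apply: closed_openC; exact: closed_closure.
by apply: measurable_open_plane; exact: open_interior.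
Qed.

Lemma chart_base_itv : base c = `]- rad c, rad c[%classic.
Proof. by apply/seteqP; split => a; rewrite /base/= in_itv/= ltr_norml. Qed.

Lemma measurable_chart_base : measurable (base c : set (measurableTypeR R)).
Proof. by rewrite chart_base_itv; exact: measurable_itv. Qed.

Lemma chart_base_lty : (@lebesgue_measure R (base c) < +oo)%E.
Proof.
rewrite chart_base_itv lebesgue_measure_itv/=.
by case: ifPn => _; rewrite ?ltry// -EFinD ltry.
Qed.

(** A direct image need not be measurable; this one is the part of the boundary
    lying in the open box. *)
Lemma measurable_chart_image : measurable (graph_pt c @` base c : set (plane R)).
Proof.
have -> : graph_pt c @` base c = bd K `&` ([set x | `|tang c x| < rad c] `&`
                                           [set x | `|nrml c x| < hgt c]).
  apply/seteqP; split => [x /[dup] Gx [a ar <-]|x [bx [tx nx]]].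
    split; first by apply: graph_pt_boundary; exists a.
    have d1 := chart_dir Kc.
    split; rewrite /= /graph_pt ?tang_frame ?nrml_frame//.
    exact: chart_in_box Kc _ ar.
  exact: boundary_graph_pt.
apply: measurableI; first exact: measurable_bd.
have op (f : point R -> R) r : continuous f ->
    measurable ([set x | `|f x| < r] : set (plane R)).
  move=> cf; apply: measurable_open_plane.
  apply: (@open_comp _ _ (fun x => `|f x|) [set y | y < r]); last exact: open_lt.
  move=> x _; apply: (continuous_comp (f := f)); first exact: cf.
  exact: norm_continuous.
by apply: measurableI; apply: op; [exact: continuous_tang|exact: continuous_nrml].
Qed.

Lemma measurable_graph_pt :
  measurable_fun setT (graph_pt c : measurableTypeR R -> plane R).
Proof.
apply/measurable_fun_pairP; split; apply: continuous_measurable_fun => a.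
  apply: (continuous_comp (f := graph_pt c)); first exact: continuous_graph_pt.
  exact: cvg_fst.
apply: (continuous_comp (f := graph_pt c)); first exact: continuous_graph_pt.
exact: cvg_snd.
Qed.

End ChartGeometry.

(** * The flux through one chart *)

Section ChartFlux.
Variable R : realType.
Local Notation leb := (@lebesgue_measure R).

Lemma ae_imply (P Q : measurableTypeR R -> Prop) : (forall a, P a -> Q a) ->
  {ae leb, forall a, P a} -> {ae leb, forall a, Q a}.
Proof.
move=> PQ; exact: (@filterS _ (almost_everywhere leb) _ _ _ PQ).
Qed.

Lemma Rintegral_frame (c : chart R) (f : plane R -> R) :
  (dir c).1 ^+ 2 + (dir c).2 ^+ 2 = 1 -> measurable_fun setT f ->
  \int[area R]_z f z = \int[area R]_z f (frame c z.1 z.2).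
Proof.
move=> d1 mf; congr fine; rewrite integralE [RHS]integralE.
have mEf : measurable_fun setT (EFin \o f) by exact/measurable_EFinP.
congr (_ - _)%E.
  rewrite (ge0_integral_frame (c := c))//; last exact: measurable_funepos.
  by apply: eq_integral => z _; rewrite !funeposE.
rewrite (ge0_integral_frame (c := c))//; last exact: measurable_funeneg.
by apply: eq_integral => z _; rewrite !funenegE.
Qed.

Lemma Rintegral_plane (f : plane R -> R) :
  (area R).-integrable setT (EFin \o f) ->
  (forall a, leb.-integrable setT (EFin \o (fun b => f (a, b)))) ->
  \int[area R]_z f z = \int[leb]_a \int[leb]_b f (a, b).
Proof.
move=> fi fai; rewrite /Rintegral -integral12_prod_meas1//; congr fine.
apply: eq_integral => a _; rewrite /fubini_F fineK//.
exact: (integrable_fin_num measurableT (fai a)).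
Qed.

Lemma measurable_Rintegral_snd (f : plane R -> R) :
  (area R).-integrable setT (EFin \o f) ->
  measurable_fun setT ((fun a => \int[leb]_b f (a, b)) : measurableTypeR R -> R).
Proof.
move=> fi; apply: (measurableT_comp (f := fine) (g := fubini_F leb (EFin \o f))) => //.
exact: (measurable_fubini_F fi).
Qed.

(** Dominated convergence needs the derivative along sequences. *)
Lemma derivative_quotient_cvg (g : R -> R) (a s : R) (k : R^nat) :
  is_derive a (1 : R) g s -> (forall n, k n != 0) -> k @ \oo --> 0 ->
  (fun n => (k n)^-1 * (g (a + k n) - g a)) @ \oo --> s.
Proof.
move=> gs k0 kcvg; have dg := @ex_derive _ _ _ _ _ _ _ gs.
have <- := @derive_val _ _ _ _ _ _ _ gs.
have k0' : k @ \oo --> 0^'.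
  move=> A A0; have [N _ hN] := kcvg _ A0; exists N => // n /hN.
  exact.
pose q (h : R) := h^-1 *: (g (h *: 1 + a) - g a).
have dq : q @ 0^' --> 'D_1 g a by exact: dg.
have -> : (fun n => (k n)^-1 * (g (a + k n) - g a)) = q \o k.
  by apply/funext => n; rewrite /q /= /GRing.scale/= mulr1 [k n + a]addrC.
exact: (cvg_comp _ _ k0' dq).
Qed.

Lemma measurable_length (K : set (point R)) (c : chart R) :
  is_lipschitz_chart K c ->
  measurable_fun setT
  ((fun a => Num.sqrt (1 + slope c a ^+ 2)) : measurableTypeR R -> R).
Proof.
move=> Kc.
have ms : measurable_fun setT (Num.sqrt : R -> R).
  by apply: continuous_measurable_fun => x; exact: sqrt_continuous.
apply: (measurableT_comp ms); apply: measurable_funD => //.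
by apply: measurable_funX; exact: chart_slope_meas Kc.
Qed.

Variables (K : set (point R)) (c : chart R) (sigma : {measure set (plane R) -> \bar R}).
Variables (n : point R -> point R) (G : point R -> R) (C r t e1 e2 : R).
Hypotheses (oK : open K) (Kfin : (area R K < +oo)%E).
Hypotheses (Kc : is_lipschitz_chart K c) (Ks : is_arc_length K sigma).
Hypothesis (Kn : is_outward_normal K n).
Hypotheses (cG : continuous G) (GC : forall x, `|G x| <= C).
Hypotheses (rrad : r < rad c) (thgt : t < hgt c).
Hypothesis (Gout : forall x, r <= `|tang c x| \/ t <= `|nrml c x| -> G x = 0).

Let d1 := chart_dir Kc.
Let al := e1 * (dir c).1 + e2 * (dir c).2.
Let be := e2 * (dir c).1 - e1 * (dir c).2.
Let g := graph c.
Let H (a b : R) := G (frame c a b).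

Let Hout a b : r <= `|a| \/ t <= `|b| -> H a b = 0.
Proof. by move=> h; apply: Gout; rewrite tang_frame// nrml_frame. Qed.

Let cH : continuous (fun z : point R => H z.1 z.2).
Proof.
move=> z; apply: (@continuous_comp _ _ _ (fun z : point R => frame c z.1 z.2)).
  exact: continuous_frame.
exact: cG.
Qed.

Let cHa a : continuous (H a).
Proof.
move=> b; apply: (@continuous_comp _ _ _ (fun b => (a, b) : point R) (fun z => H z.1 z.2)).
  by apply: continuous_pair => ?; [exact: cvg_cst|exact: cvg_id].
exact: cH.
Qed.

Let cg : continuous g. Proof. exact: continuous_chart_graph Kc. Qed.

Let cHg : continuous (fun a => H a (g a)).
Proof.
move=> a; apply: (@continuous_comp _ _ _ (fun a => (a, g a) : point R) (fun z => H z.1 z.2)).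
  by apply: continuous_pair => // ?; exact: cvg_id.
exact: cH.
Qed.

Let HC a b : `|H a b| <= C. Proof. exact: GC. Qed.

Let box : set (plane R) := `[- r, r]%classic `*` `[- t, t]%classic.

Let mbox : measurable box. Proof. exact: measurableX. Qed.

Let boxfin : (area R box < +oo)%E.
Proof.
rewrite product_measure1E// [X in (X * _)%E]lebesgue_measure_itv.
rewrite [X in (_ * X)%E]lebesgue_measure_itv/=.
by case: ifPn => _; case: ifPn => _; rewrite ?mule0 ?mul0e// -!EFinD -EFinM ltry.
Qed.

Let outbox (z : plane R) : ~ box z -> H z.1 z.2 = 0.
Proof.
move=> zb; apply: Hout; rewrite 2!leNgt.
apply/orP; rewrite -negb_and; apply/negP => /andP[h1 h2]; apply: zb.
by split; rewrite /= in_itv/= -ler_norml ltW.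
Qed.

Let under (k : R -> R) (z : point R) : R := (z.2 < k z.1)%R%:R * H z.1 z.2.

Let measurable_under k : continuous k -> measurable_fun setT (under k).
Proof.
move=> ck; apply: measurable_funM; last exact: continuous_measurable_plane.
pose A : set (plane R) := [set z : point R | z.2 < k z.1].
have -> : (fun z : point R => (z.2 < k z.1)%R%:R) = \1_A :> (plane R -> R).
  by apply/funext => z; rewrite indicE mem_setE.
apply: measurable_indic; apply: measurable_open_plane.
have -> : A = (fun z : point R => k z.1 - z.2) @^-1` [set y | 0 < y].
  by apply/seteqP; split => z /=; rewrite subr_gt0.
apply: open_comp; last exact: open_gt.
move=> z _; apply: cvgB; last exact: cvg_snd.
apply: (@continuous_comp _ _ _ (fun z : point R => z.1)); first exact: cvg_fst.
exact: ck.
Qed.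

Let integrable_under k : continuous k ->
  (area R).-integrable setT (EFin \o under k).
Proof.
move=> ck; apply: (integrable_bounded_support mbox boxfin).
- exact: measurable_under.
- exists C => z; rewrite /under normrM.
  by case: (_ < _); rewrite ?normr1 ?mul1r// normr0 mul0r (le_trans _ (HC 0 0)).
- by move=> z zb; rewrite /under outbox ?mulr0.
Qed.

Let shifted h a := g (a + - h * al) + h * be.

Let cshifted h : continuous (shifted h).
Proof.
move=> a; apply: cvgD; last exact: cvg_cst.
apply: (@continuous_comp _ _ _ (fun a => a + - h * al)); last exact: cg.
by apply: cvgD; [exact: cvg_id|exact: cvg_cst].
Qed.

Let slab h a := \int[leb]_b (step_diff (shifted h a) (g a) b * H a b).

(* Move the translation from G to K.  Where G does not vanish, the translated set
   is again the region below a graph as long as h is so small that the box is not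
   left, so the two integrals differ by the slab between the two graphs. *)
Let quotient_slab h : `|h * al| < rad c - r -> `|h * be| < hgt c - t ->
  \int[area R]_(x in K) (G (x.1 + h * e1, x.2 + h * e2) - G x) =
  \int[leb]_a slab h a.
Proof.
move=> hal hbe.
have mK : measurable (K : set (plane R)) by exact: measurable_open_plane.
have cGs : continuous (fun x : point R => G (x.1 + h * e1, x.2 + h * e2)).
  move=> x; apply: (@continuous_comp _ _ _
    (fun x : point R => (x.1 + h * e1, x.2 + h * e2) : point R)); last exact: cG.
  by apply: continuous_pair => z; (apply: cvgD; last exact: cvg_cst);
    [exact: cvg_fst|exact: cvg_snd].
have mGs := continuous_measurable_plane cGs.
have mG := continuous_measurable_plane cG.
rewrite RintegralB//; first last.
- by apply: integrable_bounded => //; exists C => x _.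
- by apply: integrable_bounded => //; exists C => x _.
have restrE (f : plane R -> R) : f \_ K = f \* \1_K.
  by apply/funext => x; rewrite patchE /= indicE; case: (x \in K); rewrite ?mulr1 ?mulr0.
rewrite [X in X - _]Rintegral_mkcond [X in _ - X]Rintegral_mkcond.
(* The chart of the translated set. *)
pose ch := Chart ((org c).1 - h * e1, (org c).2 - h * e2) (dir c) (rad c) (hgt c) g (slope c).
have chE a b : frame ch a b = frame c (a + - h * al) (b + - h * be).
  by rewrite frame_shift// /frame/=; congr (_, _); ring.
rewrite [X in X - _](@Rintegral_frame ch)//; last first.
  by rewrite restrE; apply: measurable_funM => //; exact: measurable_indic.
rewrite [X in _ - X](@Rintegral_frame c)//; last first.
  by rewrite restrE; apply: measurable_funM => //; exact: measurable_indic.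
transitivity (\int[area R]_z (under (shifted h) z - under g z)).
  rewrite RintegralB//; last 2 first.
  - exact: integrable_under.
  - exact: integrable_under.
  have boxP a b : H a b != 0 -> `|a| < r /\ `|b| < t.
    by move=> H0; split; rewrite ltNge; apply: contra_neqN H0 => h1; apply: Hout;
      [left|right].
  have KE a b : `|a| < rad c -> `|b| < hgt c ->
      (frame c a b \in K) = (b < g a).
    move=> ar bh; apply/idP/idP.
      by rewrite in_setE => /(chart_subgraph Kc ar bh).
    by move=> /(chart_subgraph Kc ar bh) ?; rewrite in_setE.
  congr (_ - _); apply: eq_Rintegral => -[a b] _; rewrite restrE /= indicE /under/=.
    have -> : G ((frame ch a b).1 + h * e1, (frame ch a b).2 + h * e2) = H a b.
      rewrite chE frame_shift//= /H; congr G.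
      by rewrite /frame/=; congr (_, _); ring.
    rewrite mulrC; have [->|/boxP[ar bt]] := eqVneq (H a b) 0; first by rewrite !mulr0.
    congr (_%:R * _); rewrite chE KE.
    - by rewrite /shifted !mulNr ltrBlDr.
    - by rewrite mulNr (le_lt_trans (ler_normB _ _))//; lra.
    - by rewrite mulNr (le_lt_trans (ler_normB _ _))//; lra.
  rewrite mulrC -/(H a b); have [->|/boxP[ar bt]] := eqVneq (H a b) 0; first by rewrite !mulr0.
  by rewrite KE//; [exact: lt_trans rrad|exact: lt_trans thgt].
apply: (etrans (Rintegral_plane (f := fun z => under (shifted h) z - under g z) _ _)).
- have := integrableB measurableT (integrable_under (@cshifted h)) (integrable_under cg).
  by apply: eq_integrable => // z _; rewrite /= EFinB.
- move=> a; have := integrable_step_diffM (shifted h a) (g a) (@cHa a) (@HC a).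
  by apply: eq_integrable => // b _; rewrite /= /under /step_diff/= mulrBl.
apply: eq_Rintegral => a _; apply: eq_Rintegral => b _.
by rewrite /under /step_diff/= mulrBl.
Qed.

Let measurable_slab h : measurable_fun setT (slab h : measurableTypeR R -> R).
Proof.
have -> : slab h = (fun a => \int[leb]_b (under (shifted h) (a, b) - under g (a, b))).
  apply/funext => a; apply: eq_Rintegral => b _.
  by rewrite /under /step_diff/= mulrBl.
apply: (@measurable_Rintegral_snd (fun z => under (shifted h) z - under g z)).
have := integrableB measurableT (integrable_under (@cshifted h)) (integrable_under cg).
by apply: eq_integrable => // z _; rewrite /= EFinB.
Qed.

Let integrable_base_indic : leb.-integrable setT
  (EFin \o (\1_(base c) : measurableTypeR R -> R)).
Proof.
apply: (@integrable_bounded_support _ _ _ leb (base c) (\1_(base c))).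
- exact: measurable_chart_base.
- exact: chart_base_lty.
- by apply: measurable_indic; exact: measurable_chart_base.
- by exists 1 => a; rewrite indicE; case: (_ \in _); rewrite ?normr1// normr0.
- by move=> a; rewrite indicE; case: (boolP (a \in _)) => // /set_mem.
Qed.

Let flux a : R := (be - al * slope c a) * H a (g a).

Let measurable_flux : measurable_fun setT (flux : measurableTypeR R -> R).
Proof.
apply: measurable_funM; last by apply: continuous_measurable_fun; exact: cHg.
apply: measurable_funB => //; apply: measurable_funM => //.
exact: chart_slope_meas Kc.
Qed.


(* The factor sqrt (1 + slope^2) of the arc length cancels the denominator of the
   normal. *)
Let boundary_flux :
  \int[sigma]_(x in bd K) (G x * ((n x).1 * e1 + (n x).2 * e2)) =
  \int[leb]_a flux a.
Proof.
have [mn1 mn2 nE] := Kn.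
set f := fun x : point R => G x * ((n x).1 * e1 + (n x).2 * e2).
have mf : measurable_fun setT (f : plane R -> R).
  apply: measurable_funM; first exact: continuous_measurable_plane.
  by apply: measurable_funD; apply: measurable_funM.
have mGa := measurable_chart_image oK Kc.
have mb := measurable_chart_base c.
have -> : \int[sigma]_(x in bd K) f x = \int[sigma]_(x in graph_pt c @` base c) f x.
  rewrite Rintegral_mkcond [RHS]Rintegral_mkcond; congr Rintegral.
  apply/funext => x; rewrite !patchE.
  have [xG|xG] := boolP (x \in graph_pt c @` base c).
    have xb : x \in bd K by move: xG; rewrite !inE; exact: graph_pt_boundary.
    by rewrite xb.
  case: ifPn => // xb; rewrite /f.
  have [->|Gx] := eqVneq (G x) 0; first by rewrite mul0r.
  have tx : `|tang c x| < r.
    by rewrite ltNge; apply: contra_neqN Gx => h; apply: Gout; left.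
  have nx : `|nrml c x| < t.
    by rewrite ltNge; apply: contra_neqN Gx => h; apply: Gout; right.
  have := boundary_graph_pt oK Kc (lt_trans tx rrad) (lt_trans nx thgt) (set_mem xb).
  by move=> /mem_set; rewrite (negbTE xG).
rewrite /Rintegral; congr fine.
rewrite (@integral_weighted_image _ _ _ _ _ leb sigma (base c) _ (graph_pt c)
  (fun a => Num.sqrt (1 + slope c a ^+ 2)))//; first last.
- by move=> A mA; exact: Ks.
- exact: measurable_length Kc.
- exact: measurable_graph_pt Kc.
transitivity (\int[leb]_(a in base c) (flux a)%:E)%E.
  apply: (@ae_eq_integral _ (measurableTypeR R) R leb (base c)
    (fun a => (flux a)%:E)
    (fun a => (f (graph_pt c a) * Num.sqrt (1 + slope c a ^+ 2))%:E)) => //.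
  - apply/measurable_funTS/measurable_EFinP; apply: measurable_funM.
      exact: (measurableT_comp mf (measurable_graph_pt Kc)).
    exact: measurable_length Kc.
  - exact/measurable_funTS/measurable_EFinP.
  - apply: (ae_imply _ (nE c Kc)) => a na ab; congr EFin.
    rewrite /f na// /flux /graph_normal/=.
    have l0 : Num.sqrt (1 + slope c a ^+ 2) != 0.
      by rewrite sqrtr_eq0 -ltNge ltr_pwDl// sqr_ge0.
    by rewrite /H /g -/(graph_pt c a) /al /be; field.
rewrite [LHS]integral_mkcond; congr (integral _ _ _); apply/funext => a.
rewrite patchE; case: ifPn => // ab; rewrite /flux Hout ?mulr0//; left.
rewrite leNgt; apply: contra ab => ar; rewrite inE /base/=.
exact: lt_trans rrad.
Qed.

(** The divergence theorem for a function supported in one box, with difference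
    quotients in place of derivatives.  The slab between the graph and its translate
    has thickness [h (be - al * slope a)] up to [o(h)] at almost every [a], and at
    most [h S] by the Lipschitz bound, so dominated convergence gives the flux.
    Difference quotients are used because [G] will carry a factor from a partition
    of unity that is only continuous. *)
Lemma cvg_chart_flux (h : R^nat) : (forall m, 0 < h m) -> h @ \oo --> 0 ->
  (fun m => (h m)^-1 *
     \int[area R]_(x in K) (G (x.1 + h m * e1, x.2 + h m * e2) - G x)) @ \oo -->
  \int[sigma]_(x in bd K) (G x * ((n x).1 * e1 + (n x).2 * e2)).
Proof.
move=> h0 hcvg; rewrite boundary_flux.
have [L L0 gL] := lipschitz_bound (chart_graph Kc).
pose S := L * `|al| + `|be|.
have slab_le m a : `|(h m)^-1 * slab (h m) a| <= C * S * \1_(base c) a.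
  have C0 : 0 <= C by exact: le_trans (HC 0 0).
  have S0 : 0 <= S by rewrite addr_ge0// mulr_ge0.
  have [ab|ab] := boolP (a \in base c); rewrite indicE ?ab ?(negbTE ab) ?mulr1 ?mulr0.
    rewrite normrM gtr0_norm ?invr_gt0// ler_pdivrMl//.
    rewrite (le_trans (Rintegral_step_diff_le _ _ (@cHa a) (@HC a)))//.
    rewrite mulrCA ler_wpM2l// /shifted addrAC.
    rewrite (le_trans (ler_normD _ _))// /S [leRHS]mulrDr.
    rewrite lerD//; last by rewrite normrM gtr0_norm.
    rewrite (le_trans (gL _ _))// mulrCA ler_wpM2l//.
    have -> : a + - h m * al - a = - (h m * al) by ring.
    by rewrite normrN normrM gtr0_norm.
  rewrite /slab (_ : Rintegral _ _ _ = 0) ?mulr0 ?normr0//.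
  rewrite /Rintegral integral0_eq// => b _; rewrite Hout ?mulr0//; left.
  rewrite leNgt; apply: contra ab => ar; rewrite inE /base/=.
  exact: lt_trans rrad.
have idom : leb.-integrable setT
    (EFin \o (fun a => C * S * \1_(base c) a : R)).
  have := integrableZl measurableT (C * S) integrable_base_indic.
  by apply: eq_integrable => // a _; rewrite /= EFinM.
have mq m : measurable_fun setT
    ((fun a => (h m)^-1 * slab (h m) a) : measurableTypeR R -> R).
  by apply: measurable_funM => //; exact: measurable_slab.
have slab_cvg : {ae leb, forall a, setT a ->
    (fun m => ((h m)^-1 * slab (h m) a)%:E) @ \oo --> (flux a)%:E}.
  apply: (ae_imply _ (chart_slope Kc)) => a ga _.
  apply: cvg_EFin; first by apply: nearW.
  (* w m is the thickness of the slab at a, divided by h m. *)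
  pose w m := (h m)^-1 * (g (a + - h m * al) - g a) + be.
  have wcvg : w @ \oo --> be - al * slope c a.
    rewrite addrC; apply: cvgD; last exact: cvg_cst.
    have [al0|al0] := eqVneq al 0.
      rewrite al0 mul0r oppr0.
      under eq_fun do rewrite mulr0 addr0 subrr mulr0.
      exact: cvg_cst.
    have k0 m : - h m * al != 0 by rewrite mulf_neq0// oppr_eq0 gt_eqF.
    have kcvg : (fun m => - h m * al) @ \oo --> 0.
      rewrite -(mul0r al) -oppr0; apply: cvgM; last exact: cvg_cst.
      exact: cvgN.
    have := derivative_quotient_cvg ga k0 kcvg.
    have al_cvg : (fun=> - al : R) @ \oo --> - al by exact: cvg_cst.
    move=> /(cvgM al_cvg); rewrite mulNr.
    have -> // : (fun=> - al : R) \* (fun m => (- h m * al)^-1 * (g (a + - h m * al) - g a))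
      = (fun m => (h m)^-1 * (g (a + - h m * al) - g a)).
    apply/funext => m /=; by field; rewrite al0 gt_eqF.
  have := cvg_step_diff (v := g a) (@cHa a) (@HC a) h0 hcvg wcvg.
  rewrite -/(flux a); have -> // : (fun m => (h m)^-1 *
     \int[leb]_b (step_diff (g a + h m * w m) (g a) b * H a b)) =
     (fun m => (h m)^-1 * slab (h m) a).
  apply/funext => m; congr (_ * _); rewrite /slab; congr (Rintegral _ _ _).
  apply/funext => b; congr (step_diff _ _ _ * _).
  by rewrite /w /shifted; field; rewrite gt_eqF.
have mE f : measurable_fun setT (f : measurableTypeR R -> R) ->
    measurable_fun setT (EFin \o f).
  by move=> mf; exact/measurable_EFinP.
have slab_dom : {ae leb, forall a, forall m, setT a ->
    (`|((h m)^-1 * slab (h m) a)%:E| <= (C * S * \1_(base c) a)%:E)%E}.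
  by apply: aeW => a m _; rewrite /= lee_fin.
have [iflux _ icvg] := dominated_convergence measurableT (fun m => mE _ (mq m))
  (mE _ measurable_flux) slab_cvg idom slab_dom.
have islab m : leb.-integrable setT (EFin \o (slab (h m) : measurableTypeR R -> R)).
  have ih : leb.-integrable setT
      (EFin \o ((fun a => (h m)^-1 * slab (h m) a) : measurableTypeR R -> R)).
    apply: (le_integrable measurableT _ _ idom); first exact: mE.
    move=> a _; rewrite /= lee_fin (le_trans (slab_le m a))//; exact: ler_norm.
  have := integrableZl measurableT (h m) ih.
  apply: eq_integrable => // a _; rewrite /= -EFinM mulrA divff ?mul1r//.
  by rewrite gt_eqF.
have Rcvg : (fun m => (h m)^-1 * \int[leb]_a slab (h m) a) @ \oo --> \int[leb]_a flux a.
  have iE : (\int[leb]_a (EFin \o flux) a = (\int[leb]_a flux a)%:E)%E.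
    by rewrite fineK//; exact: (integrable_fin_num measurableT iflux).
  rewrite iE in icvg.
  apply: cvg_trans (fine_cvg icvg); apply: near_eq_cvg; apply: nearW => m.
  by rewrite /= -RintegralZl.
have hcvg' (k d : R) : 0 < d -> \forall m \near \oo, `|h m * k| < d.
  move=> d0; have hk : (fun m => h m * k) @ \oo --> 0.
    by rewrite -(mul0r k); apply: cvgM => //; exact: cvg_cst.
  by move/cvgrPdist_lt : hk => /(_ _ d0); apply: filterS => m; rewrite sub0r normrN.
apply: cvg_trans Rcvg; apply: near_eq_cvg; near=> m.
rewrite quotient_slab//; near: m; apply: hcvg'; rewrite subr_gt0//.
Unshelve. all: by end_near. Qed.

End ChartFlux.

(** * Compact sets of the plane *)

Section PlaneCompact.
Variable R : realType.
Implicit Types (x y : point R) (A K : set (point R)).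

Lemma ler_norm_fst x : `|x.1| <= `|x|.
Proof. by rewrite prod_normE le_max lexx. Qed.

Lemma ler_norm_snd x : `|x.2| <= `|x|.
Proof. by rewrite prod_normE le_max lexx orbT. Qed.

Lemma prod_norm_le x r : `|x.1| <= r -> `|x.2| <= r -> `|x| <= r.
Proof. by move=> h1 h2; rewrite prod_normE ge_max h1. Qed.

Definition square (r : R) : set (point R) := `[- r, r]%classic `*` `[- r, r]%classic.

Lemma squareP r x : square r x <-> `|x| <= r.
Proof.
rewrite /square/= !in_itv/= -!ler_norml; split=> [[h1 h2]|h].
  exact: prod_norm_le.
by split; [exact: le_trans (ler_norm_fst x) h|exact: le_trans (ler_norm_snd x) h].
Qed.

Lemma compact_square r : compact (square r).
Proof. by apply: compact_setX; exact: segment_compact. Qed.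

Lemma bounded_set_bound A : bounded_set A ->
  exists2 r, 0 < r & forall x, A x -> `|x| <= r.
Proof.
move=> [M [_ hM]]; exists (Num.max M 0 + 1).
  by rewrite ltr_wpDl// le_max lexx orbT.
move=> x Ax; apply: (hM (Num.max M 0 + 1)) => //.
by rewrite ltr_pwDr// le_max lexx.
Qed.

Lemma closure_bounded A r : (forall x, A x -> `|x| <= r) ->
  forall x, closure A x -> `|x| <= r.
Proof.
move=> Ar x clx; apply/squareP.
have csq : closed (square r).
  by apply: compact_closed; [exact: norm_hausdorff|exact: compact_square].
by apply: csq => B /clx[y [Ay By]]; exists y; split => //; apply/squareP; exact: Ar.
Qed.

Lemma compact_closure A : bounded_set A -> compact (closure A).
Proof.
move=> /bounded_set_bound[r _ Ar].
apply: (subclosed_compact _ (@compact_square r)); first exact: closed_closure.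
by move=> x /(closure_bounded Ar) /squareP.
Qed.

Lemma compact_bd A : bounded_set A -> compact (bd A).
Proof.
move=> bA; apply: (subclosed_compact _ (compact_closure bA)); last by move=> x [].
by apply: closedI; [exact: closed_closure|apply: open_closedC; exact: open_interior].
Qed.

Lemma continuous_bounded_square (f : point R -> R) r : continuous f ->
  exists2 C, 0 <= C & forall x, `|x| <= r -> `|f x| <= C.
Proof.
move=> cf.
have := continuous_compact (continuous_subspaceT cf) (@compact_square r).
move=> /compact_bounded[M [_ hM]]; exists (Num.max M 0 + 1).
  by rewrite ltW// ltr_wpDl// le_max lexx orbT.
move=> x xr; apply: (hM (Num.max M 0 + 1)).
  by rewrite ltr_pwDr// le_max lexx.
by exists x => //; apply/squareP.
Qed.

Lemma finite_ball_cover A (rho : point R -> R) : compact A ->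
  (forall x, A x -> 0 < rho x) ->
  exists2 s : seq (point R), {in s, forall x, A x} &
    forall y, A y -> exists2 x, x \in s & `|y - x| < rho x.
Proof.
pose T : ptopologicalType :=
  HB.pack (R * R)%type (isPointed.Build (R * R)%type (0, 0)).
move=> cA rho0; have {}cA : cover_compact (A : set T) by rewrite -compact_cover.
pose U x : set (point R) := [set y | `|y - x| < rho x].
have [|x Ax|s sA As] := cA (point R) A U.
- move=> x _; rewrite (_ : U x = ball x (rho x)); first exact: ball_open.
  by rewrite -ball_normE; apply/seteqP; split => y; rewrite /ball_/= distrC.
- by exists x => //; rewrite /U/= subrr normr0; exact: rho0.
exists (finmap.enum_fset s) => [x xs|y /As[x xs]]; last by exists x.
by have := sA _ xs; rewrite inE.
Qed.

Lemma area_bounded K : bounded_set K -> open K -> (area R K < +oo)%E.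
Proof.
move=> /bounded_set_bound[r r0 Kr] oK.
pose S : set (plane R) := square r.
have mS : measurable S by exact: measurableX.
apply: (@le_lt_trans _ _ (area R S)).
  apply: le_measure; rewrite ?inE//; first exact: measurable_open_plane.
  by move=> x /Kr /squareP.
rewrite product_measure1E// [X in (X * _)%E]lebesgue_measure_itv.
rewrite [X in (_ * X)%E]lebesgue_measure_itv/=.
by case: ifPn => _; rewrite ?mule0 ?mul0e// -!EFinD -EFinM ltry.
Qed.

End PlaneCompact.

(** * Arc length and normal of a Lipschitz boundary *)

Section LipschitzBoundary.
Variable R : realType.
Local Notation leb := (@lebesgue_measure R).
Variables (K : set (point R)) (sigma : {measure set (plane R) -> \bar R}).
Variable n : point R -> point R.
Hypotheses (oK : open K) (bK : bounded_set K) (Klip : has_lipschitz_boundary K).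
Hypotheses (Ks : is_arc_length K sigma) (Kn : is_outward_normal K n).

(** The difference quotients are bounded by the Lipschitz constant. *)
Lemma slope_bounded c : is_lipschitz_chart K c ->
  exists2 L, 0 <= L & {ae leb, forall a, `|slope c a| <= L}.
Proof.
move=> Kc; have [L L0 gL] := lipschitz_bound (chart_graph Kc); exists L => //.
apply: (ae_imply _ (chart_slope Kc)) => a ga.
have k0 m : @harmonic R m != 0 by rewrite gt_eqF// harmonic_gt0.
have := derivative_quotient_cvg ga k0 cvg_harmonic.
move=> /cvg_norm; apply: (closed_cvg (fun y => y <= L)); first exact: closed_le.
apply: nearW => m; rewrite normrM normfV ler_pdivrMl ?normr_gt0//.
by rewrite (le_trans (gL _ _))// [a + _]addrC addrK mulrC.
Qed.

Lemma arc_chart_lty c : is_lipschitz_chart K c ->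
  (sigma (graph_pt c @` base c) < +oo)%E.
Proof.
move=> Kc; have := Ks Kc measurableT; rewrite setTI => ->.
have [L L0 sL] := slope_bounded Kc.
have mb := measurable_chart_base c.
apply: (@le_lt_trans _ _ (\int[leb]_(a in base c) (Num.sqrt (1 + L ^+ 2))%:E)%E).
  apply: ae_ge0_le_integral => //.
  - apply/measurable_funTS/measurable_EFinP.
    by apply: (eq_measurable_fun _ _ (measurable_length Kc)) => a _; rewrite indicT mul1r.
  - apply: (ae_imply _ sL) => a aL _; rewrite lee_fin indicT mul1r.
    rewrite ler_wsqrtr// lerD2l -(real_normK (num_real (slope c a))).
    by rewrite lerXn2r// nnegrE.
rewrite integral_cst//; apply: lte_mul_pinfty => //.
exact: chart_base_lty.
Qed.

Lemma chart_choice : exists ch : point R -> chart R,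
  forall x, bd K x -> is_lipschitz_chart K (ch x) /\ org (ch x) = x.
Proof.
suff /choice[ch chP] : forall x, exists c : chart R,
    bd K x -> is_lipschitz_chart K c /\ org c = x by exists ch.
move=> x; have [bx|nbx] := pselect (bd K x).
  by have [c Kc cx] := Klip bx; exists c.
by exists (Chart (0, 0) (0, 0) 0 0 (cst 0) (cst 0)) => /nbx.
Qed.

(** The frame coordinates of [y] are at most twice the sup norm of [y - org c]. *)
Lemma near_org (c : chart R) y : is_lipschitz_chart K c ->
  `|y - org c| < Num.min (rad c) (hgt c) / 4 ->
  `|tang c y| < rad c / 2 /\ `|nrml c y| < hgt c / 2.
Proof.
move=> Kc; rewrite ltr_pdivlMr// lt_min => /andP[yr yh].
have d1 := chart_dir Kc.
have d11 : `|(dir c).1| <= 1 by exact: unit_le1 d1.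
have d21 : `|(dir c).2| <= 1 by apply: (@unit_le1 _ _ (dir c).1); rewrite addrC.
have y1 : `|y.1 - (org c).1| <= `|y - org c| by exact: ler_norm_fst (y - org c).
have y2 : `|y.2 - (org c).2| <= `|y - org c| by exact: ler_norm_snd (y - org c).
have M (a b : R) : `|a| <= `|y - org c| -> `|b| <= 1 -> `|a * b| <= `|y - org c|.
  by move=> ha hb; rewrite normrM -[leRHS]mulr1 ler_pM.
split.
  rewrite /tang (le_lt_trans (ler_normD _ _))//.
  have := M _ _ y1 d11; have := M _ _ y2 d21; lra.
rewrite /nrml (le_lt_trans (ler_normB _ _))//.
have := M _ _ y2 d11; have := M _ _ y1 d21; lra.
Qed.

Lemma measure_seq_cover (I : eqType) (s : seq I) (G : I -> set (plane R))
    (A : set (plane R)) : measurable A -> {in s, forall i, measurable (G i)} ->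
  (forall y, A y -> exists2 i, i \in s & G i y) ->
  (sigma A <= \sum_(i <- s) sigma (A `&` G i))%E.
Proof.
elim: s A => [|i s IH] A mA mG AG.
  rewrite big_nil (_ : A = set0) ?measure0//.
  by apply/seteqP; split => // y /AG[].
have mGi : measurable (G i) by apply: mG; rewrite inE eqxx.
rewrite big_cons -{1}(setUIDK A (G i)).
apply: (@le_trans _ _ (sigma (A `&` G i) + sigma (A `\` G i))%E).
  apply: measureU2; [exact: measurableI|exact: measurableD].
rewrite leeD2l//.
apply: (@le_trans _ _ (\sum_(j <- s) sigma ((A `\` G i) `&` G j))%E).
  apply: IH; first exact: measurableD.
    by move=> j js; apply: mG; rewrite inE js orbT.
  by move=> y [/AG[j]]; rewrite inE => /predU1P[->//|js Gj _]; exists j.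
rewrite [X in (X <= _)%E]big_seq [X in (_ <= X)%E]big_seq; apply: lee_sum => j js.
have mGj : measurable (G j) by apply: mG; rewrite inE js orbT.
apply: le_measure; rewrite ?inE.
- by apply: measurableI => //; exact: measurableD.
- exact: measurableI.
- by move=> y [[Ay _] Gj].
Qed.

(** By compactness finitely many charts describe the whole boundary, so a bound
    on the arc length can be checked in one chart at a time. *)
Lemma arc_le_charts : exists (ch : point R -> chart R) (s : seq (point R)),
  (forall x, x \in s -> is_lipschitz_chart K (ch x)) /\
  forall A : set (plane R), measurable A -> A `<=` bd K ->
    (sigma A <= \sum_(x <- s) sigma (A `&` (graph_pt (ch x) @` base (ch x))))%E.
Proof.
have [ch chP] := chart_choice.
pose rho x := Num.min (rad (ch x)) (hgt (ch x)) / 4.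
have [|s sb scov] := finite_ball_cover (rho := rho) (compact_bd bK).
  by move=> x /chP[Kc _]; rewrite divr_gt0// lt_min (chart_rad Kc) (chart_hgt Kc).
exists ch; exists s; split=> [x /sb /chP[Kc _] //|A mA AK].
apply: measure_seq_cover => //.
  by move=> x /sb /chP[Kc _]; exact: (measurable_chart_image oK Kc).
move=> y /AK by_; have [x xs xy] := scov _ by_; exists x => //.
have [Kc cx] := chP _ (sb _ xs).
have [|ty ny] := near_org (y := y) Kc; first by rewrite cx.
have r0 := chart_rad Kc; have h0 := chart_hgt Kc.
by apply: (boundary_graph_pt oK Kc _ _ by_); lra.
Qed.

Lemma arc_bd_lty : (sigma (bd K) < +oo)%E.
Proof.
have [ch [s [chP le_s]]] := arc_le_charts.
have mb := measurable_bd oK.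
apply: le_lt_trans (le_s _ mb _) _ => //.
rewrite big_seq; apply: lte_sum_pinfty => x xs.
apply: le_lt_trans (arc_chart_lty (chP _ xs)).
have mG := measurable_chart_image oK (chP _ xs).
by apply: le_measure; rewrite ?inE//; exact: measurableI.
Qed.

Definition bad_normal : set (plane R) :=
  [set x | bd K x /\ (n x).1 ^+ 2 + (n x).2 ^+ 2 != 1].

Lemma measurable_bad_normal : measurable bad_normal.
Proof.
have [mn1 mn2 _] := Kn.
have -> : bad_normal = bd K `&`
    (fun x : plane R => ((n x).1 ^+ 2 + (n x).2 ^+ 2 : measurableTypeR R)) @^-1` ~` [set 1].
  by apply/seteqP; split => x [bx /eqP nx].
apply: measurableI; first exact: measurable_bd.
rewrite -[X in measurable X]setTI.
have mf : measurable_fun setT (fun x : plane R => (n x).1 ^+ 2 + (n x).2 ^+ 2).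
  by apply: measurable_funD; apply: measurable_funX.
by apply: mf => //; apply: measurableC; exact: measurable_set1.
Qed.

(** In each chart the normal agrees almost everywhere with an explicit unit vector. *)
Lemma arc_bad_normal : sigma bad_normal = 0%E.
Proof.
have [ch [s [chP le_s]]] := arc_le_charts.
have mb := measurable_bad_normal.
have [_ _ nE] := Kn.
apply/eqP; rewrite eq_le measure_ge0 andbT.
apply: le_trans (le_s _ mb _) _; first by move=> x [].
rewrite big_seq big1// => x xs; have Kc := chP _ xs.
rewrite (Ks Kc mb).
rewrite (@ae_eq_integral _ (measurableTypeR R) R leb _ (cst 0%E)) ?integral0//.
- exact: measurable_chart_base.
- apply/measurable_funTS/measurable_EFinP; apply: measurable_funM.
    exact: (measurableT_comp (measurable_indic mb) (measurable_graph_pt Kc)).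
  exact: measurable_length Kc.
- apply: (ae_imply _ (nE _ Kc)) => a na ab.
  rewrite indicE (_ : _ \in _ = false) ?mul0r//.
  apply/negP; rewrite inE => -[_]; rewrite na// /graph_normal/= => /eqP; apply.
  have d1 := chart_dir Kc.
  have l2 : Num.sqrt (1 + slope (ch x) a ^+ 2) ^+ 2 = 1 + slope (ch x) a ^+ 2.
    by rewrite sqr_sqrtr// addr_ge0 ?sqr_ge0.
  rewrite !expr_div_n -mulrDl l2.
  have l0 : 1 + slope (ch x) a ^+ 2 != 0 by rewrite gt_eqF// ltr_pwDl// sqr_ge0.
  apply: (canLR (mulfK l0)); rewrite mul1r.
  apply: (@etrans _ _ ((1 + slope (ch x) a ^+ 2) *
    ((dir (ch x)).1 ^+ 2 + (dir (ch x)).2 ^+ 2))); first by ring.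
  by rewrite d1 mulr1.
Qed.

End LipschitzBoundary.

(** * The divergence theorem on a Lipschitz domain *)

Section FiniteSums.
Variable R : realType.

Lemma cvg_seq_sum (I : eqType) (s : seq I) (u : I -> R^nat) (l : I -> R) :
  (forall i, i \in s -> u i @ \oo --> l i) ->
  (fun m => \sum_(i <- s) u i m) @ \oo --> \sum_(i <- s) l i.
Proof.
elim: s => [_|i s IH ul].
  by rewrite big_nil; under eq_fun do rewrite big_nil; exact: cvg_cst.
rewrite big_cons; under eq_fun do rewrite big_cons.
apply: cvgD; first by apply: ul; rewrite inE eqxx.
by apply: IH => j js; apply: ul; rewrite inE js orbT.
Qed.

Lemma integrable_seq_sum d (T : measurableType d) (mu : {measure set T -> \bar R})
    (D : set T) (I : Type) (s : seq I) (f : I -> T -> R) : measurable D ->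
  (forall i, mu.-integrable D (EFin \o f i)) ->
  mu.-integrable D (EFin \o (fun x => \sum_(i <- s) f i x)).
Proof.
move=> mD fi.
have := @integrable_sum _ T R mu D mD I s xpredT (fun i => EFin \o f i) (fun i _ => fi i).
by apply: eq_integrable => // x _; rewrite /= sumEFin.
Qed.

Lemma Rintegral_seq_sum d (T : measurableType d) (mu : {measure set T -> \bar R})
    (D : set T) (I : Type) (s : seq I) (f : I -> T -> R) : measurable D ->
  (forall i, mu.-integrable D (EFin \o f i)) ->
  \int[mu]_(x in D) (\sum_(i <- s) f i x) = \sum_(i <- s) \int[mu]_(x in D) f i x.
Proof.
move=> mD fi; elim: s => [|i s IH].
  rewrite big_nil; under eq_Rintegral do rewrite big_nil.
  by rewrite /Rintegral integral0.
rewrite big_cons -IH -RintegralD//; last exact: integrable_seq_sum.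
by apply: eq_Rintegral => x _; rewrite big_cons.
Qed.

End FiniteSums.

Section Divergence.
Variable R : realType.
Variables (K : set (point R)) (sigma : {measure set (plane R) -> \bar R}).
Variables (n : point R -> point R) (e1 e2 : R).
Hypotheses (oK : open K) (bK : bounded_set K) (Klip : has_lipschitz_boundary K).
Hypotheses (Ks : is_arc_length K sigma) (Kn : is_outward_normal K n).
Implicit Types (x y : point R) (G F : point R -> R).

Let ne x := (n x).1 * e1 + (n x).2 * e2.
Let sh (h : R) x : point R := (x.1 + h * e1, x.2 + h * e2).

Let mK : measurable (K : set (plane R)). Proof. exact: measurable_open_plane. Qed.

Let Kfin : (area R K < +oo)%E. Proof. exact: area_bounded. Qed.

Let continuous_sh h : continuous (sh h).
Proof.
by apply: continuous_pair => z; (apply: cvgD; last exact: cvg_cst);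
  [exact: cvg_fst|exact: cvg_snd].
Qed.

Lemma integrable_continuous G : continuous G ->
  (area R).-integrable K (EFin \o (G : plane R -> R)).
Proof.
move=> cG; have [r r0 Kr] := bounded_set_bound bK.
have [C C0 GC] := continuous_bounded_square r cG.
apply: integrable_bounded => //; first exact: continuous_measurable_plane.
by exists C => x /Kr; exact: GC.
Qed.

Let measurable_ne : measurable_fun setT (ne : plane R -> R).
Proof.
by have [mn1 mn2 _] := Kn; apply: measurable_funD; apply: measurable_funM.
Qed.

Let ne_bounded x : (n x).1 ^+ 2 + (n x).2 ^+ 2 = 1 -> `|ne x| <= `|e1| + `|e2|.
Proof.
move=> n1.
rewrite /ne (le_trans (ler_normD _ _))// !normrM lerD//.
  by rewrite ler_piMl// (unit_le1 n1).
by rewrite ler_piMl// (@unit_le1 _ _ (n x).1)// addrC.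
Qed.

(** The normal is bounded only outside [bad_normal], which is a null set. *)
Lemma integrable_normal_flux G : continuous G ->
  sigma.-integrable (bd K) (EFin \o (fun x : plane R => G x * ne x)).
Proof.
move=> cG.
have mbd := measurable_bd oK.
have mbad := measurable_bad_normal oK Kn.
have mG : measurable_fun setT (fun x : plane R => G x * ne x).
  by apply: measurable_funM => //; exact: continuous_measurable_plane.
apply: (negligible_integrable mbad mbd _ _).2.
- exact/measurable_funTS/measurable_EFinP.
- exact: arc_bad_normal.
have [r r0 Kr] := bounded_set_bound bK.
have [C C0 GC] := continuous_bounded_square r cG.
apply: integrable_bounded => //; first exact: measurableD.
  apply: le_lt_trans (arc_bd_lty oK bK Klip Ks).
  by apply: le_measure; rewrite ?inE; [exact: measurableD|exact: mbd|move=> x []].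
exists (C * (`|e1| + `|e2|)) => x [[clx ix] nbad]; rewrite normrM ler_pM//.
  exact/GC/(closure_bounded Kr).
apply: ne_bounded; apply: contrapT => n1; apply: nbad.
by split => //; apply/eqP.
Qed.

(* The divergence theorem in a form without derivatives of G.  It is linear in G and
   makes sense for continuous G, so it can be localised by a partition of unity that
   is merely continuous. *)
Let flux_cvg G :=
  (fun m => (harmonic m)^-1 * \int[area R]_(x in K) (G (sh (harmonic m) x) - G x))
    @ \oo --> \int[sigma]_(x in bd K) (G x * ne x).

Let flux_cvg_boundary x : bd K x -> exists2 r : R, 0 < r &
  forall G, continuous G -> (exists C, forall y, `|G y| <= C) ->
  (forall y, r <= `|y - x| -> G y = 0) -> flux_cvg G.
Proof.
move=> /Klip[c Kc cx]; exists (Num.min (rad c) (hgt c) / 4).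
  by rewrite divr_gt0// lt_min (chart_rad Kc) (chart_hgt Kc).
move=> G cG [C GC] G0.
have r0 := chart_rad Kc; have h0 := chart_hgt Kc.
apply: (@cvg_chart_flux _ K c sigma n G C (rad c / 2) (hgt c / 2) e1 e2) => //.
- lra.
- lra.
- move=> y hy; apply: G0; rewrite leNgt; apply/negP; rewrite -cx => /(near_org Kc)[ty ny].
  by case: hy; rewrite leNgt ?ty ?ny.
- by move=> m; exact: harmonic_gt0.
- exact: cvg_harmonic.
Qed.

Let near_small (k d : R) : 0 <= k -> 0 < d ->
  \forall m \near \oo, @harmonic R m * k < d.
Proof.
move=> k0 d0; have hk : (fun m => @harmonic R m * k) @ \oo --> 0.
  by rewrite -(mul0r k); apply: cvgM; [exact: cvg_harmonic|exact: cvg_cst].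
move/cvgrPdist_lt : hk => /(_ d) [] // N _ hN; exists N => // m /hN /=.
by rewrite sub0r normrN; exact: le_lt_trans (ler_norm _).
Qed.

Let sh_dist (h : R) x : 0 < h -> `|sh h x - x| <= h * (`|e1| + `|e2|).
Proof.
move=> h0; have -> : sh h x - x = (h * e1, h * e2).
  apply: (@etrans _ _ (x.1 + h * e1 - x.1, x.2 + h * e2 - x.2)) => //.
  by congr (_, _); ring.
by apply: prod_norm_le => /=;
  rewrite normrM (gtr0_norm h0) (ler_wpM2l (ltW h0))// ?lerDl ?lerDr.
Qed.

(* A function supported well inside K stays there when translated a little, so by
   translation invariance both sides vanish. *)
Let flux_cvg_interior x : K x -> exists2 r : R, 0 < r &
  forall G, continuous G -> (exists C, forall y, `|G y| <= C) ->
  (forall y, r <= `|y - x| -> G y = 0) -> flux_cvg G.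
Proof.
move=> Kx.
have [r /= r0 rK] : exists2 r : R, 0 < r & forall y, `|y - x| < r -> K y.
  have /nbhs_ballP[r /= r0 rK] : nbhs x K by exact: open_nbhs_nbhs.
  by exists r => // y yx; apply: rK; rewrite -ball_normE /ball_/= distrC.
exists (r / 2); first by rewrite divr_gt0.
move=> G cG [C GC] G0; rewrite /flux_cvg.
have -> : \int[sigma]_(y in bd K) (G y * ne y) = 0.
  rewrite /Rintegral integral0_eq// => y [_ yK]; rewrite G0 ?mul0r//.
  rewrite leNgt; apply/negP => yx; apply: yK; apply: open_nbhs_nbhs; split => //.
  by apply: rK; lra.
apply: (@cvg_trans _ ((fun=> 0 : R) @ \oo)); last exact: cvg_cst.
apply: near_eq_cvg; near=> m.
have : @harmonic R m * (`|e1| + `|e2|) < r / 2.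
  by near: m; apply: near_small; rewrite ?addr_ge0// divr_gt0.
have : 0 < @harmonic R m by exact: harmonic_gt0.
set h : R := harmonic m; move=> h0 hs.
have cGs : continuous (G \o sh h).
  by move=> y; apply: continuous_comp; [exact: continuous_sh|exact: cG].
rewrite RintegralB//; [|exact: (integrable_continuous cGs)|exact: integrable_continuous].
have restr (f : plane R -> R) : (forall y, ~ K y -> f y = 0) ->
    \int[area R]_(y in K) f y = \int[area R]_y f y.
  move=> f0; rewrite Rintegral_mkcond; congr Rintegral.
  apply/funext => y; rewrite patchE; case: ifPn => // /negP yK.
  by rewrite f0// => Ky; apply: yK; exact/mem_set.
rewrite (restr (G \o sh h)); last first.
  move=> y nK; apply: G0; rewrite leNgt; apply/negP => yx; apply: nK; apply: rK.
  have -> : y - x = (sh h y - x) - (sh h y - y) by rewrite opprB [RHS]addrC addrA subrK.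
  have := ler_normB (sh h y - x) (sh h y - y); have := sh_dist y h0; lra.
rewrite [X in _ - X]restr; last first.
  move=> y nK; apply: G0; rewrite leNgt; apply/negP => yx; apply: nK; apply: rK; lra.
pose c := Chart (h * e1, h * e2) (1, 0) 1 1 (cst 0) (cst 0).
rewrite [X in _ - X](@Rintegral_frame _ c)//=; first last.
- exact: continuous_measurable_plane.
- by rewrite expr1n expr0n/= addr0.
rewrite [X in _ - X](_ : _ = \int[area R]_y (G \o sh h) y) ?subrr ?mulr0//.
apply: eq_Rintegral => y _; rewrite /= /frame /sh/=; congr G.
by congr (_, _); ring.
Unshelve. all: by end_near. Qed.

Let flux_cvg_local x : closure K x -> exists r : R, 0 < r /\
  forall G, continuous G -> (exists C, forall y, `|G y| <= C) ->
  (forall y, r <= `|y - x| -> G y = 0) -> flux_cvg G.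
Proof.
move=> clx; have [Kx|nKx] := pselect (K x).
  by have [r r0 H] := flux_cvg_interior Kx; exists r.
have bx : bd K x by split => // /interior_subset.
by have [r r0 H] := flux_cvg_boundary bx; exists r.
Qed.

(* The bump functions of the partition of unity. *)
Let tent (r : R) x y : R := Num.max 0 (r - `|y - x|).

Let tent_ge0 r x y : 0 <= tent r x y. Proof. by rewrite le_max lexx. Qed.

Let continuous_tent r x : continuous (tent r x).
Proof.
move=> y; apply: (@continuous_max _ _ (cst 0) (fun y => r - `|y - x|)).
  exact: cvg_cst.
apply: cvgB; first exact: cvg_cst.
apply: cvg_norm; apply: cvgB; [exact: cvg_id|exact: cvg_cst].
Qed.

Let tent_lip r x y y' : tent r x y - `|y - y'| <= tent r x y'.
Proof.
have : `|y' - x| <= `|y - y'| + `|y - x|.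
  by rewrite -(distrC y') (le_trans _ (ler_normD _ _))// addrA subrK.
rewrite /tent /Num.max; case: ifPn; case: ifPn; have := normr_ge0 (y - y'); lra.
Qed.

Let flux_cvg_continuous F : continuous F -> flux_cvg F.
Proof.
move=> cF.
have /choice[rho rhoP] : forall x, exists r : R, closure K x -> 0 < r /\
    forall G, continuous G -> (exists C, forall y, `|G y| <= C) ->
    (forall y, r <= `|y - x| -> G y = 0) -> flux_cvg G.
  move=> x; have [/flux_cvg_local[r rP]|nx] := pselect (closure K x); first by exists r.
  by exists 0 => /nx.
have [|s sK scov] := finite_ball_cover (rho := fun x => rho x / 2) (compact_closure bK).
  by move=> x /rhoP[r0 _]; rewrite divr_gt0.
have [s0 s00 s0le] : exists2 s0 : R, 0 < s0 & forall x, x \in s -> s0 <= rho x / 2.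
  elim: s sK {scov} => [|x s IH] sK; first by exists 1.
  have [|s0 s00 s0le] := IH; first by move=> y ys; apply: sK; rewrite inE ys orbT.
  have rx : 0 < rho x by have [] := rhoP _ (sK _ (mem_head _ _)).
  exists (Num.min s0 (rho x / 2)); first by rewrite lt_min s00 divr_gt0.
  move=> y; rewrite inE ge_min => /predU1P[->|/s0le ->//]; rewrite lexx orbT//.
(* The sum S of the tents is at least s0 on the closure of K.  Dividing by the
   maximum of S and s0 / 2 avoids zeros elsewhere and changes nothing near K. *)
pose S y := \sum_(x <- s) tent (rho x) x y.
pose G x y := F y * tent (rho x) x y / Num.max (S y) (s0 / 2).
have cS : continuous S.
  apply: (@continuous_big R _ +%R 0 xpredT); first exact: add_continuous.
  by move=> x _; exact: continuous_tent.
have max0 y : 0 < Num.max (S y) (s0 / 2) by rewrite lt_max divr_gt0// orbT.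
have cG x : continuous (G x).
  move=> y; apply: cvgM; first by apply: cvgM; [exact: cF|exact: continuous_tent].
  apply: cvgV; first by rewrite gt_eqF.
  apply: (@continuous_max _ _ S (cst (s0 / 2))); first exact: cS.
  exact: cvg_cst.
have Gout x y : rho x <= `|y - x| -> G x y = 0.
  by move=> yx; rewrite /G /tent max_l ?mulr0 ?mul0r// subr_le0.
have Gb x : exists C, forall y, `|G x y| <= C.
  have [C C0 FC] := continuous_bounded_square (`|x| + `|rho x|) cF.
  exists (C * `|rho x| / (s0 / 2)) => y.
  have CC : 0 <= C * `|rho x| / (s0 / 2).
    by apply: divr_ge0; [exact: mulr_ge0|apply: divr_ge0 => //; exact: ltW].
  have [/Gout ->|yx] := leP (rho x) (`|y - x|); first by rewrite normr0.
  rewrite /G normrM normrM ler_pM//.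
    rewrite ler_pM//.
      apply: FC; rewrite -[y](subrK x) addrC (le_trans (ler_normD _ _))// lerD2l.
      by rewrite (le_trans (ltW yx))// ler_norm.
    rewrite ger0_norm// /tent ge_max normr_ge0/=.
    by rewrite (le_trans _ (ler_norm _))// gerBl.
  rewrite normfV lef_pV2 ?posrE ?normr_gt0 ?gt_eqF// ?divr_gt0//.
  by rewrite (le_trans _ (ler_norm _))// le_max lexx orbT.
have sumG y : s0 / 2 <= S y -> \sum_(x <- s) G x y = F y.
  move=> sy; rewrite /G -mulr_suml -mulr_sumr -/(S y) max_l//.
  by rewrite mulfK// gt_eqF// (lt_le_trans _ sy)// divr_gt0.
have SK y : closure K y -> s0 <= S y.
  move=> /scov[x xs yx]; apply: (le_trans (s0le _ xs)).
  rewrite /S (big_rem x xs)/= (le_trans (y := tent (rho x) x y))//.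
    by rewrite /tent le_max; apply/orP; right; lra.
  by rewrite lerDl; apply: sumr_ge0.
have Slip y y' : S y - (size s)%:R * `|y - y'| <= S y'.
  rewrite /S; elim: (s) => [|x s1 IH]; first by rewrite !big_nil/= mul0r subr0.
  rewrite !big_cons /= -natr1 mulrDl mul1r.
  have := tent_lip (rho x) x y y'; lra.
have cvgG : (fun m => \sum_(x <- s) (harmonic m)^-1 *
      \int[area R]_(y in K) (G x (sh (harmonic m) y) - G x y)) @ \oo -->
    \sum_(x <- s) \int[sigma]_(y in bd K) (G x y * ne y).
  apply: cvg_seq_sum => x /sK /rhoP[_]; apply; [exact: cG|exact: Gb|exact: Gout].
rewrite /flux_cvg.
have -> : \int[sigma]_(y in bd K) (F y * ne y) =
    \sum_(x <- s) \int[sigma]_(y in bd K) (G x y * ne y).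
  rewrite -Rintegral_seq_sum; first last.
  - by move=> x; exact: integrable_normal_flux.
  - exact: measurable_bd.
  apply: eq_Rintegral => y; rewrite inE => -[cly _].
  rewrite -mulr_suml sumG//; apply: le_trans (SK _ cly).
  by rewrite ler_pdivrMr// ler_pMr// ler1n.
apply: cvg_trans cvgG; apply: near_eq_cvg; near=> m.
(* S is Lipschitz with constant size s, so a small shift keeps it above s0 / 2. *)
have : @harmonic R m * ((size s)%:R * (`|e1| + `|e2|)) < s0 / 2.
  near: m; apply: near_small; last by rewrite divr_gt0.
  by rewrite mulr_ge0// addr_ge0.
have : 0 < @harmonic R m by exact: harmonic_gt0.
set h : R := harmonic m; move=> h0 hs.
rewrite -mulr_sumr; congr (_ * _).
have cGs x : continuous (G x \o sh h).
  by move=> y; apply: continuous_comp; [exact: continuous_sh|exact: cG].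
rewrite -Rintegral_seq_sum//; last first.
  move=> x; have := integrableB mK (integrable_continuous (@cGs x))
    (integrable_continuous (@cG x)).
  by apply: eq_integrable => // y _; rewrite /= EFinB.
apply: eq_Rintegral => y; rewrite inE => Ky.
have Sy := SK y (subset_closure Ky).
rewrite sumrB !sumG//; first by rewrite (le_trans _ Sy)// ler_pdivrMr// ler_pMr// ler1n.
apply: le_trans (Slip y _); rewrite distrC.
have : (size s)%:R * `|sh h y - y| <= (size s)%:R * (h * (`|e1| + `|e2|)).
  by rewrite ler_wpM2l// sh_dist.
by rewrite mulrCA; lra.
Unshelve. all: by end_near. Qed.

(** The sequence of [flux_cvg] has a second limit: by the mean value theorem the
    difference quotients of [F] are bounded on K, and they converge to [dF]. *)
Theorem divergence_theorem F dF : continuous F -> continuous dF ->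
  (forall x (t : R), is_derive t (1 : R) (fun t => F (sh t x)) (dF (sh t x))) ->
  \int[area R]_(x in K) dF x =
  \int[sigma]_(x in bd K) (F x * ((n x).1 * e1 + (n x).2 * e2)).
Proof.
move=> cF cdF FdF.
have := flux_cvg_continuous cF.
suff Fcvg : (fun m => (harmonic m)^-1 *
    \int[area R]_(x in K) (F (sh (harmonic m) x) - F x)) @ \oo -->
    \int[area R]_(x in K) dF x.
  by move=> h; exact: (norm_cvg_unique Fcvg h).
have [r r0 Kr] := bounded_set_bound bK.
have [C C0 dFC] := continuous_bounded_square (r + (`|e1| + `|e2|)) cdF.
have cFs h : continuous (F \o sh h).
  by move=> y; apply: continuous_comp; [exact: continuous_sh|exact: cF].
have sh0 x : sh 0 x = x by rewrite /sh !mul0r !addr0 -surjective_pairing.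
have mvt (h : R) x : 0 < h -> h <= 1 -> K x -> `|h^-1 * (F (sh h x) - F x)| <= C.
  move=> h0 h1 Kx.
  have ctf : {within `[0, h], continuous (fun t => F (sh t x))}.
    apply: derivable_within_continuous => t _; exact: (@ex_derive _ _ _ _ _ _ _ (FdF x t)).
  have [t] := MVT h0 (fun t _ => FdF x t) ctf.
  rewrite in_itv/= => /andP[t0 th]; rewrite sh0 subr0 => ->.
  rewrite mulrCA mulVf ?mulr1 ?gt_eqF//; apply: dFC.
  rewrite -(subrK x (sh t x)) addrC (le_trans (ler_normD _ _))// lerD ?Kr//.
  rewrite (le_trans (sh_dist _ t0))// ler_piMl ?addr_ge0//.
  exact: le_trans (ltW th) h1.
have harm0 m : 0 < @harmonic R m by exact: harmonic_gt0.
have harm1 m : @harmonic R m <= 1 by rewrite /= invf_le1 ?ler1n.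
pose q m x := (@harmonic R m)^-1 * (F (sh (harmonic m) x) - F x).
have mq m : measurable_fun setT (q m : plane R -> R).
  by apply: measurable_funM => //; apply: measurable_funB;
    [exact: (continuous_measurable_plane (@cFs _))|exact: continuous_measurable_plane].
have iq m : (area R).-integrable K (EFin \o (q m : plane R -> R)).
  apply: integrable_bounded => //; exists C => x Kx; exact: (mvt _ _ (harm0 m) (harm1 m) Kx).
have idF := integrable_continuous cdF.
have qcvg : {ae area R, forall x, K x -> (EFin \o (q ^~ x)) @ \oo --> (dF x)%:E}.
  apply: aeW => x Kx; apply: cvg_EFin; first by apply: nearW.
  have k0 m : @harmonic R m != 0 by rewrite gt_eqF// harmonic_gt0.
  have := derivative_quotient_cvg (FdF x 0) k0 cvg_harmonic; rewrite sh0.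
  by under eq_fun do rewrite add0r.
have qdom : {ae area R, forall x, forall m, K x -> (`|(q m x)%:E| <= C%:E)%E}.
  by apply: aeW => x m Kx; rewrite lee_fin; exact: (mvt _ _ (harm0 m) (harm1 m) Kx).
have icst : (area R).-integrable K (EFin \o (cst C : plane R -> R)).
  by apply: integrable_bounded => //; exists `|C|.
have mE f : measurable_fun setT (f : plane R -> R) -> measurable_fun K (EFin \o f).
  by move=> mf; exact/measurable_funTS/measurable_EFinP.
have [_ _ icvg] := dominated_convergence mK (fun m => mE _ (mq m))
  (mE _ (continuous_measurable_plane cdF)) qcvg icst qdom.
have iE : (\int[area R]_(x in K) (EFin \o dF) x = (\int[area R]_(x in K) dF x)%:E)%E.
  by rewrite fineK//; exact: (integrable_fin_num mK idF).
rewrite iE in icvg.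
apply: cvg_trans (fine_cvg icvg); apply: near_eq_cvg; apply: nearW => m.
rewrite /= -RintegralZl//.
have := integrableB mK (integrable_continuous (@cFs (harmonic m))) (integrable_continuous cF).
by apply: eq_integrable => // y _; rewrite /= EFinB.
Qed.

End Divergence.

(** * Polynomials in two variables and Green's formula *)

Section Polynomials2.
Variable R : realType.
Implicit Types (w z : poly2 R) (x : point R).

Lemma evD w z x : ev (w + z) x = ev w x + ev z x.
Proof. exact: mevalD. Qed.

Lemma evM w z x : ev (w * z) x = ev w x * ev z x.
Proof. exact: mevalM. Qed.

Lemma dxM w z : dx (w * z) = dx w * z + w * dx z.
Proof. exact: mderivM. Qed.

Lemma dyM w z : dy (w * z) = dy w * z + w * dy z.
Proof. exact: mderivM. Qed.

Lemma poly2_ind (P : poly2 R -> Prop) :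
  (forall c : R, P (mpolyC 2 c)) -> (forall i : 'I_2, P (mpolyX R (mnm1 i))) ->
  (forall w z, P w -> P z -> P (w + z)) -> (forall w z, P w -> P z -> P (w * z)) ->
  forall w, P w.
Proof.
move=> PC PX PD PM w.
have P0 : P 0 by rewrite -(mpolyC0 2 R).
have P1 : P 1 by rewrite -(mpolyC1 2 R).
elim/mpolyind : w => // c m w _ _ Pw; apply: (PD _ _ _ Pw).
rewrite -mul_mpolyC; apply: (PM _ _ (PC c)).
rewrite mpolyXE_id; apply: (big_ind P P1 PM) => i _.
by elim: (m i) => [|k IH]; rewrite ?expr0// exprS; exact: PM.
Qed.

Lemma continuous_ev w : continuous (ev w).
Proof.
move: w; apply: (poly2_ind (P := fun w => continuous (ev w))) => [c|i|w z cw cz|w z cw cz].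
- have -> : ev (mpolyC 2 c) = cst c by apply/funext => x; exact: mevalC.
  by move=> x; exact: cvg_cst.
- have -> : ev (mpolyX R (mnm1 i)) = fun x : point R => if i == ord0 then x.1 else x.2.
    by apply/funext => x; exact: mevalXU.
  by case: (i == ord0) => x; [exact: cvg_fst|exact: cvg_snd].
- have -> : ev (w + z) = fun x => ev w x + ev z x by apply/funext => x; exact: evD.
  by move=> x; apply: cvgD; [exact: cw|exact: cz].
- have -> : ev (w * z) = fun x => ev w x * ev z x by apply/funext => x; exact: evM.
  by move=> x; apply: cvgM; [exact: cw|exact: cz].
Qed.

(** Both sides are derivations in [w], so constants and variables suffice. *)
Lemma is_derive_ev w (e1 e2 : R) x (t : R) :
  is_derive t (1 : R) (fun t => ev w (x.1 + t * e1, x.2 + t * e2))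
    (e1 * ev (dx w) (x.1 + t * e1, x.2 + t * e2)
     + e2 * ev (dy w) (x.1 + t * e1, x.2 + t * e2)).
Proof.
have lin (a e : R) : is_derive t (1 : R) (fun t => a + t * e) e.
  have -> : (fun t => a + t * e) = cst a + ((id : R -> R) * cst e) by apply/funext.
  apply: (is_derive_eq (is_deriveD (is_derive_cst a t 1)
    (is_deriveM (is_derive_id t 1) (is_derive_cst e t 1)))).
  by rewrite /GRing.scale/= mulr0 mulr1 !add0r.
move: w; apply: (poly2_ind (P := fun w => is_derive t (1 : R)
    (fun t => ev w (x.1 + t * e1, x.2 + t * e2))
    (e1 * ev (dx w) (x.1 + t * e1, x.2 + t * e2)
     + e2 * ev (dy w) (x.1 + t * e1, x.2 + t * e2)))) => [c|i|w z IHw IHz|w z IHw IHz].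
- have d0 i y : ev (mderiv i (mpolyC 2 c)) y = 0 by rewrite mderivC /ev meval0.
  rewrite !d0 !mulr0 addr0.
  have -> : (fun t : R => ev (mpolyC 2 c) (x.1 + t * e1, x.2 + t * e2)) = cst c.
    by apply/funext => s; exact: mevalC.
  exact: is_derive_cst.
- have dX (j : 'I_2) y : ev (mderiv j (mpolyX R (mnm1 i))) y = (i == j)%:R.
    rewrite mderivX /ev mevalZ mnm1E; case: eqVneq => [->|]; last by rewrite mul0r.
    rewrite mul1r (_ : mnm_sub _ _ = mnm0) ?mpolyX0 ?meval1//.
    by apply/mnmP => k; rewrite mnmBE mnm0E subnn.
  rewrite !dX.
  have -> : (fun t : R => ev (mpolyX R (mnm1 i)) (x.1 + t * e1, x.2 + t * e2)) =
            (fun t : R => if i == ord0 then x.1 + t * e1 else x.2 + t * e2).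
    by apply/funext => s; exact: mevalXU.
  have [i0|i0] := eqVneq i ord0.
    have -> : (i == ord_max) = false by rewrite i0.
    by rewrite mulr1 mulr0 addr0; exact: lin.
  have -> : (i == ord_max) = true.
    by case: i i0 {dX} => [[|[|]]].
  by rewrite mulr1 mulr0 add0r; exact: lin.
- have -> : (fun t => ev (w + z) (x.1 + t * e1, x.2 + t * e2)) =
    (fun t : R => ev w (x.1 + t * e1, x.2 + t * e2))
    + (fun t : R => ev z (x.1 + t * e1, x.2 + t * e2)).
    by apply/funext => s; exact: evD.
  apply: (is_derive_eq (is_deriveD IHw IHz)).
  rewrite /dx /dy !mderivD !evD; ring.
- have -> : (fun t => ev (w * z) (x.1 + t * e1, x.2 + t * e2)) =
    (fun t : R => ev w (x.1 + t * e1, x.2 + t * e2))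
    * (fun t : R => ev z (x.1 + t * e1, x.2 + t * e2)).
    by apply/funext => s; exact: evM.
  apply: (is_derive_eq (is_deriveM IHw IHz)).
  rewrite dxM dyM !evD !evM /GRing.scale/=; ring.
Qed.

End Polynomials2.

Section Green.
Variables (R : realType) (M : mesh R).
Implicit Types (i : 'I_(nelt M)) (w z : poly2 R).

Lemma elt_bounded i : bounded_set (elt (m := M) i).
Proof.
have [r [rr hr]] := mesh_dom_bounded M; exists r; split => // y ry x /mesh_elt_sub.
exact: hr.
Qed.

(** The divergence theorem for the product [w * z], with the derivation [d] in the
    direction [(e1, e2)]. *)
Lemma green i (d : poly2 R -> poly2 R) (e1 e2 : R) w z :
  (forall a b, d (a * b) = d a * b + a * d b) ->
  (forall a x, ev (d a) x = e1 * ev (dx a) x + e2 * ev (dy a) x) ->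
  ipK i (ev (d w)) (ev z) + ipK i (ev w) (ev (d z)) =
  ipdK i (fun x => ev w x * (nx i x * e1 + ny i x * e2)) (ev z).
Proof.
move=> dM dE; have oi : open (elt (m := M) i) by exact: mesh_elt_open.
have int2 (a b : poly2 R) : (area R).-integrable (elt (m := M) i)
    (EFin \o ((fun x => ev a x * ev b x) : plane R -> R)).
  apply: integrable_continuous => //; first exact: elt_bounded.
  by move=> x; apply: cvgM; exact: continuous_ev.
rewrite /ipK -RintegralD//; last exact: measurable_open_plane.
have dwz (x : point R) (t : R) : is_derive t (1 : R)
    (fun t => ev (w * z) (x.1 + t * e1, x.2 + t * e2))
    (ev (d (w * z)) (x.1 + t * e1, x.2 + t * e2)).
  by rewrite dE; exact: is_derive_ev.
transitivity (\int[area R]_(x in elt (m := M) i) ev (d (w * z)) x).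
  by apply: eq_Rintegral => x _; rewrite dM evD !evM.
rewrite (divergence_theorem oi (elt_bounded i) (@mesh_lipschitz _ M i)
  (@mesh_arc _ M i) (mesh_normal i) (@continuous_ev _ (w * z))
  (@continuous_ev _ (d (w * z))) dwz).
by apply: eq_Rintegral => x _; rewrite evM mulrAC.
Qed.

Lemma green_x i w z :
  ipK i (ev (dx w)) (ev z) + ipK i (ev w) (ev (dx z)) =
  ipdK i (fun x => ev w x * nx i x) (ev z).
Proof.
rewrite (@green i _ 1 0); [|exact: dxM|by move=> a x; rewrite mul1r mul0r addr0].
by apply: eq_Rintegral => x _; rewrite mulr1 mulr0 addr0.
Qed.

Lemma green_y i w z :
  ipK i (ev (dy w)) (ev z) + ipK i (ev w) (ev (dy z)) =
  ipdK i (fun x => ev w x * ny i x) (ev z).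
Proof.
rewrite (@green i _ 0 1); [|exact: dyM|by move=> a x; rewrite mul1r mul0r add0r].
by apply: eq_Rintegral => x _; rewrite mulr1 mulr0 add0r.
Qed.

End Green.

(** * Traces on the mesh skeleton *)

Section Skeleton.
Variables (R : realType) (M : mesh R).
Local Notation E := ('I_(nelt M)).
Local Notation el i := (elt (m := M) i).
Implicit Types (i j l : E) (f g : point R -> R) (x : point R).

Lemma elt_open i : open (el i). Proof. exact: mesh_elt_open. Qed.

Lemma measurable_bd_elt i : measurable (bd (el i) : set (plane R)).
Proof. exact: (measurable_bd (@elt_open i)). Qed.

Lemma null_bigcup (T : finType) (F : T -> set (plane R)) :
  (forall t, measurable (F t)) -> (forall t, arc M (F t) = 0%E) ->
  measurable (\bigcup_t F t) /\ arc M (\bigcup_t F t) = 0%E.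
Proof.
move=> mF F0.
have mU : measurable (\bigcup_t F t) by apply: countable_bigcupT_measurable.
split=> //; apply/eqP; rewrite eq_le measure_ge0 andbT.
apply: (le_trans (@measure_seq_cover _ (arc M) T (enum T) F _ mU (fun t _ => mF t) _)).
  by move=> y [t _ Ft]; exists t => //; rewrite mem_enum.
rewrite big1// => t _; apply/eqP; rewrite eq_le measure_ge0 andbT -(F0 t).
by apply: le_measure; rewrite ?inE//; exact: measurableI.
Qed.

Definition triple (t : E * E * E) : set (plane R) :=
  if uniq [:: t.1.1; t.1.2; t.2]
  then bd (el t.1.1) `&` bd (el t.1.2) `&` bd (el t.2) else set0.

(** The null set to be removed: outside of it normals are unit vectors and at most
    two elements meet. *)
Definition exceptional : set (plane R) :=
  \bigcup_i bad_normal (el i) (normal i) `|` \bigcup_t triple t.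

Lemma exceptional_null : measurable exceptional /\ arc M exceptional = 0%E.
Proof.
have [m1 n1] := @null_bigcup E (fun i => bad_normal (el i) (normal i))
  (fun i => measurable_bad_normal (@elt_open i) (mesh_normal i))
  (fun i => arc_bad_normal (@elt_open i) (@elt_bounded _ M i) (@mesh_lipschitz _ M i)
              (@mesh_arc _ M i) (mesh_normal i)).
have [|t|m2 n2] := @null_bigcup _ triple.
- move=> t; rewrite /triple; case: ifPn => // _.
  by apply: measurableI; [apply: measurableI|]; exact: measurable_bd_elt.
- by rewrite /triple; case: ifPn => [/mesh_faces//|_]; exact: measure0.
split; first exact: measurableU.
apply/eqP; rewrite eq_le measure_ge0 andbT.
apply: le_trans (measureU2 _ m1 m2) _.
by rewrite [X in (X + _)%E]n1 [X in (_ + X)%E]n2 adde0.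
Qed.

Definition face i : set (plane R) := bd (el i) `\` exceptional.

Lemma measurable_face i : measurable (face i).
Proof. by apply: measurableD; [exact: measurable_bd_elt|have [] := exceptional_null]. Qed.

Lemma face_lty i : (arc M (face i) < +oo)%E.
Proof.
apply: le_lt_trans (arc_bd_lty (@elt_open i) (@elt_bounded _ M i)
  (@mesh_lipschitz _ M i) (@mesh_arc _ M i)).
apply: le_measure; rewrite ?inE; [exact: measurable_face|exact: measurable_bd_elt|].
by move=> x [].
Qed.

Lemma face_normal i x : face i x -> nx i x ^+ 2 + ny i x ^+ 2 = 1.
Proof.
move=> [bx nex]; apply: contrapT => nn; apply: nex; left; exists i => //.
by split => //; apply/eqP.
Qed.

Lemma face_bd i j x : face i x -> bd (el j) x -> face j x.
Proof. by move=> [_ nex] bj; split. Qed.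

Lemma face_two i j l x : j != i -> l != i -> face i x -> bd (el j) x ->
  bd (el l) x -> j = l.
Proof.
move=> ji li [bx nex] bj bl; apply/eqP/negP => jl; apply: nex; right.
exists (i, j, l) => //; rewrite /triple/= !inE negb_or ![i == _]eq_sym ji li.
by rewrite (introN idP jl).
Qed.

(** Traces are only bounded where the normal has length one, so boundedness is
    asked on [face i]; measurability is asked everywhere. *)
Definition tracelike i f := measurable_fun [set: plane R] (f : plane R -> R) /\
  exists C, forall x, face i x -> `|f x| <= C.

Lemma tracelike_integrable i f : tracelike i f ->
  (arc M).-integrable (face i) (EFin \o (f : plane R -> R)).
Proof.
move=> [mf fC]; apply: integrable_bounded => //.
- exact: measurable_face.
- exact: face_lty.
Qed.

Lemma tracelike_cst i (k : R) : tracelike i (fun=> k).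
Proof. by split; [exact: measurable_cst|exists `|k|]. Qed.

Lemma tracelikeD i f g : tracelike i f -> tracelike i g ->
  tracelike i (fun x => f x + g x).
Proof.
move=> [mf [C fC]] [mg [D gD]]; split; first exact: measurable_funD.
by exists (C + D) => x fx; rewrite (le_trans (ler_normD _ _))// lerD ?fC ?gD.
Qed.

Lemma tracelikeM i f g : tracelike i f -> tracelike i g ->
  tracelike i (fun x => f x * g x).
Proof.
move=> [mf [C fC]] [mg [D gD]]; split; first exact: measurable_funM.
by exists (C * D) => x fx; rewrite normrM ler_pM ?fC ?gD.
Qed.

Lemma tracelikeZ i f (k : R) : tracelike i f -> tracelike i (fun x => k * f x).
Proof. by move=> tf; apply: tracelikeM => //; exact: tracelike_cst. Qed.

Lemma tracelikeB i f g : tracelike i f -> tracelike i g ->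
  tracelike i (fun x => f x - g x).
Proof.
move=> tf /(tracelikeZ (-1)) tg; have := tracelikeD tf tg.
by congr tracelike; apply/funext => x; rewrite mulN1r.
Qed.

Lemma tracelike_sum i (s : seq E) (P : pred E) (F : E -> point R -> R) :
  (forall j, tracelike i (F j)) -> tracelike i (fun x => \sum_(j <- s | P j) F j x).
Proof.
move=> tF; elim: s => [|j s IH].
  have := tracelike_cst i 0.
  by congr tracelike; apply/funext => x; rewrite big_nil.
have [Pj|nPj] := boolP (P j).
  have := tracelikeD (tF j) IH.
  by congr tracelike; apply/funext => x; rewrite big_cons Pj.
by move: IH; congr tracelike; apply/funext => x; rewrite big_cons (negbTE nPj).
Qed.

Lemma tracelike_continuous i f : continuous f -> tracelike i f.
Proof.
move=> cf; split; first exact: continuous_measurable_plane.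
have [r r0 Kr] := bounded_set_bound (elt_bounded i).
have [C C0 fC] := continuous_bounded_square r cf.
by exists C => x [[clx _] _]; apply: fC; exact: closure_bounded Kr _ clx.
Qed.

Lemma tracelike_indic i (A : set (plane R)) : measurable A -> tracelike i \1_A.
Proof.
move=> mA; split; first exact: measurable_indic.
by exists 1 => x _; rewrite indicE; case: (_ \in _); rewrite ?normr1 ?normr0.
Qed.

Lemma tracelike_nx i : tracelike i (nx i).
Proof.
have [m1 _ _] := mesh_normal (m := M) i; split => //.
by exists 1 => x /face_normal /unit_le1.
Qed.

Lemma tracelike_ny i : tracelike i (ny i).
Proof.
have [_ m2 _] := mesh_normal (m := M) i; split => //.
by exists 1 => x /face_normal; rewrite addrC => /unit_le1.
Qed.

Lemma ext_indic i (w : E -> point R -> R) x :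
  ext i w x = \1_(dom M) x * \sum_(j <- index_enum E | j != i) \1_(bd (el j)) x * w j x.
Proof.
rewrite /ext indicE; case: ifPn => xd; last by rewrite mul0r.
rewrite mul1r big_mkcondr; apply: eq_bigr => j ji.
by rewrite indicE; case: (x \in _); rewrite ?mul1r ?mul0r.
Qed.

Lemma tracelike_ext i (w : E -> point R -> R) : (forall j, tracelike j (w j)) ->
  tracelike i (ext i w).
Proof.
move=> tw; rewrite (funext (ext_indic i w)).
apply: tracelikeM.
  have odom : open (dom M) by exact: mesh_dom_open.
  by apply: tracelike_indic; exact: measurable_open_plane.
apply: tracelike_sum => j; have [mw [C wC]] := tw j; split.
  by apply: measurable_funM => //; apply: measurable_indic; exact: measurable_bd_elt.
exists `|C| => x fx; rewrite indicE; case: (boolP (x \in _)) => [|_].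
  by rewrite inE mul1r => /(face_bd fx)/wC/le_trans; apply; exact: ler_norm.
by rewrite mul0r normr0.
Qed.

Lemma tracelike_avg i (w : E -> point R -> R) : (forall j, tracelike j (w j)) ->
  tracelike i (avg i w).
Proof.
move=> tw; have := tracelikeZ (2^-1) (tracelikeD (tw i) (tracelike_ext i tw)).
by congr tracelike; apply/funext => x; rewrite /avg mulrC.
Qed.

Lemma tracelike_ev i (w : poly2 R) : tracelike i (ev w).
Proof. by apply: tracelike_continuous; exact: continuous_ev. Qed.

Lemma tracelike_flux (s : state M) i : tracelike i (normal_flux s i).
Proof.
apply: tracelikeD; apply: tracelikeM; try exact: tracelike_ev.
  exact: tracelike_nx.
exact: tracelike_ny.
Qed.

Lemma tracelike_phat Phi (s : state M) i : tracelike i (phat Phi s i).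
Proof.
apply: tracelikeD.
  by apply: tracelike_avg => j; exact: tracelike_ev.
apply: tracelikeZ; apply: tracelike_avg => j; exact: tracelike_flux.
Qed.

Lemma ipdK_face i f g : tracelike i f -> tracelike i g ->
  ipdK i f g = \int[arc M]_(x in face i) (f x * g x).
Proof.
move=> tf tg; have [mex ex0] := exceptional_null.
have tfg := tracelikeM tf tg.
rewrite /ipdK /Rintegral; congr fine.
apply: negligible_integral => //; first exact: measurable_bd_elt.
apply: (negligible_integrable mex (@measurable_bd_elt i) _ ex0).2.
  by apply/measurable_funTS/measurable_EFinP; case: tfg.
exact: tracelike_integrable tfg.
Qed.

Lemma faceD i f g : tracelike i f -> tracelike i g ->
  \int[arc M]_(x in face i) (f x + g x) =
  \int[arc M]_(x in face i) f x + \int[arc M]_(x in face i) g x.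
Proof.
move=> tf tg; apply: RintegralD; [exact: measurable_face|exact: tracelike_integrable..].
Qed.

Lemma faceZ i f (k : R) : tracelike i f ->
  \int[arc M]_(x in face i) (k * f x) = k * \int[arc M]_(x in face i) f x.
Proof.
move=> tf; apply: RintegralZl; [exact: measurable_face|exact: tracelike_integrable].
Qed.

Lemma face_le i f g : tracelike i f -> tracelike i g ->
  (forall x, face i x -> f x <= g x) ->
  \int[arc M]_(x in face i) f x <= \int[arc M]_(x in face i) g x.
Proof.
move=> tf tg fg; apply: le_Rintegral => //; first exact: measurable_face.
  exact: tracelike_integrable.
exact: tracelike_integrable.
Qed.

Lemma face_sum i (s : seq E) (P : pred E) (F : E -> point R -> R) :
  (forall j, tracelike i (F j)) ->
  \int[arc M]_(x in face i) (\sum_(j <- s | P j) F j x) =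
  \sum_(j <- s | P j) \int[arc M]_(x in face i) F j x.
Proof.
move=> tF; elim: s => [|j s IH].
  rewrite big_nil; under eq_Rintegral do rewrite big_nil.
  by rewrite /Rintegral integral0.
rewrite big_cons -IH; case: ifPn => Pj.
  rewrite -faceD//; last exact: tracelike_sum.
  by apply: eq_Rintegral => x _; rewrite big_cons Pj.
by apply: eq_Rintegral => x _; rewrite big_cons (negbTE Pj).
Qed.

(** Each point of the skeleton outside the exceptional set lies on at most two
    element boundaries, so summing exterior traces over all elements counts every
    interior trace at most once. *)
Lemma sum_exterior_le (g : E -> point R -> R) :
  (forall j, tracelike j (g j)) -> (forall j x, 0 <= g j x) ->
  \sum_i \int[arc M]_(x in face i)
     (\sum_(j <- index_enum E | j != i) \1_(bd (el j)) x * g j x) <=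
  \sum_i \int[arc M]_(x in face i) g i x.
Proof.
move=> tg g0.
have tig i j : tracelike i (fun x => \1_(bd (el j)) x * g j x).
  have [mg [C gC]] := tg j; split.
    by apply: measurable_funM => //; apply: measurable_indic; exact: measurable_bd_elt.
  exists `|C| => x fx; rewrite indicE; case: (boolP (x \in _)) => [|_].
    by rewrite inE mul1r => /(face_bd fx)/gC/le_trans; apply; exact: ler_norm.
  by rewrite mul0r normr0.
have tij i j : tracelike j (fun x => \1_(bd (el i)) x * g j x).
  by apply: tracelikeM => //; apply: tracelike_indic; exact: measurable_bd_elt.
have swap i j : \int[arc M]_(x in face i) (\1_(bd (el j)) x * g j x) =
                \int[arc M]_(x in face j) (\1_(bd (el i)) x * g j x).
  rewrite [LHS]Rintegral_mkcond [RHS]Rintegral_mkcond; congr Rintegral.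
  apply/funext => x; rewrite !patchE !indicE.
  have fE l : (x \in face l) = (x \in bd (el l)) && (x \notin exceptional).
    by rewrite /face in_setD.
  rewrite !fE; case: (x \in bd (el i)); case: (x \in bd (el j));
    case: (x \in exceptional) => //=;
    by rewrite ?mul0r ?mul1r.
under eq_bigr do rewrite face_sum//.
rewrite (exchange_big_dep xpredT)//=; apply: ler_sum => j _.
under eq_bigr do rewrite swap.
rewrite -face_sum//; apply: face_le => //; first exact: tracelike_sum.
move=> x fx.
have [/existsP[i /andP[ij xi]]|/existsPn none] :=
    boolP [exists i : E, (j != i) && (x \in bd (el i))]; last first.
  rewrite big1// => i ij; rewrite indicE.
  by have := none i; rewrite ij/= => /negbTE ->; rewrite mul0r.
rewrite (bigD1 i)//= big1.
  by rewrite addr0 indicE xi mul1r.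
move=> l /andP[jl li]; rewrite indicE; case: (boolP (x \in _)) => [xl|]; last by rewrite mul0r.
have := @face_two j i l x; rewrite ![_ == j]eq_sym => /(_ ij jl fx (set_mem xi) (set_mem xl)).
by move=> il; rewrite il eqxx in li.
Qed.

(** At most one exterior trace is present at a point of [face i], so the square of
    the sum is bounded by the sum of the squares. *)
Lemma ext_sqr_le i (w : E -> point R -> R) x : face i x ->
  ext i w x ^+ 2 <= \sum_(j <- index_enum E | j != i) \1_(bd (el j)) x * w j x ^+ 2.
Proof.
move=> fx; rewrite ext_indic.
have dom_le (y z : R) : 0 <= z -> y ^+ 2 <= z -> (\1_(dom M) x * y) ^+ 2 <= z.
  by move=> z0 yz; rewrite indicE; case: (_ \in _); rewrite ?mul1r// mul0r expr0n.
have pos j : 0 <= \1_(bd (el j)) x * w j x ^+ 2.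
  by rewrite indicE mulr_ge0// sqr_ge0.
apply: dom_le; first by apply: sumr_ge0 => j _; exact: pos.
have [/existsP[i' /andP[ij xi]]|/existsPn none] :=
    boolP [exists j : E, (j != i) && (x \in bd (el j))]; last first.
  rewrite big1 ?expr0n/=; first by apply: sumr_ge0 => j _; exact: pos.
  move=> j ji; rewrite indicE.
  by have := none j; rewrite ji/= => /negbTE ->; rewrite mul0r.
rewrite [X in X ^+ 2](bigD1 i')//= big1; last first.
  move=> l /andP[jl li]; rewrite indicE.
  case: (boolP (x \in _)) => [xl|]; last by rewrite mul0r.
  have il := face_two ij jl fx (set_mem xi) (set_mem xl).
  by rewrite il eqxx in li.
rewrite (bigD1 i')//=.
by rewrite addr0 indicE xi !mul1r lerDl; apply: sumr_ge0 => j _; exact: pos.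
Qed.

End Skeleton.

(** * The energy identity on one element *)

Section Energy.
Variables (R : realType) (M : mesh R).
Variables (p : nat) (Phi gamma f0 beta0 ym dt : R) (s s' : state M).
Hypotheses (deg' : state_deg p s') (step : ihdg_step p Phi gamma f0 beta0 ym dt s s').
Local Notation E := ('I_(nelt M)).
Implicit Types (i : E) (g : point R -> R) (x : point R).

Let f := coriolis f0 beta0 ym.

Lemma continuous_coriolis : continuous f.
Proof.
move=> x; apply: cvgD; first exact: cvg_cst.
apply: cvgM; first exact: cvg_cst.
by apply: cvgB; [exact: cvg_snd|exact: cvg_cst].
Qed.

Let measurable_elt i : measurable (elt (m := M) i : set (plane R)).
Proof. exact: (measurable_open_plane (@elt_open _ M i)). Qed.

Let integrable_ip i g1 g2 : continuous g1 -> continuous g2 ->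
  (area R).-integrable (elt (m := M) i) (EFin \o ((fun x => g1 x * g2 x) : plane R -> R)).
Proof.
move=> c1 c2; apply: integrable_continuous; [exact: elt_open|exact: elt_bounded|].
by move=> x; apply: cvgM; [exact: c1|exact: c2].
Qed.

Lemma ipKZl i k g1 g2 : continuous g1 -> continuous g2 ->
  ipK i (fun x => k * g1 x) g2 = k * ipK i g1 g2.
Proof.
move=> c1 c2; rewrite /ipK -RintegralZl//; last exact: integrable_ip.
by apply: eq_Rintegral => x _; rewrite mulrA.
Qed.

Lemma ipKDl i g1 g2 g3 : continuous g1 -> continuous g2 -> continuous g3 ->
  ipK i (fun x => g1 x + g2 x) g3 = ipK i g1 g3 + ipK i g2 g3.
Proof.
move=> c1 c2 c3; rewrite /ipK -RintegralD//; last 2 first.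
- exact: integrable_ip.
- exact: integrable_ip.
by apply: eq_Rintegral => x _; rewrite mulrDl.
Qed.

Lemma ipKC i g1 g2 : ipK i g1 g2 = ipK i g2 g1.
Proof. by apply: eq_Rintegral => x _; rewrite mulrC. Qed.

(** The sum of the three tested equations minus the two Green formulas; [cor] is the
    Coriolis term, which enters the second and the third equation with opposite
    signs. *)
Lemma energy_algebra (P g dt' a uu vv cor ud du vd dv b1 b2 b3 b4 b5 : R) :
  dt'^-1 * a - (P * ud + P * vd) + b3 = 0 ->
  P / dt' * uu - P * du + b4 = P * cor - g * P * uu ->
  P / dt' * vv - P * dv + b5 = - P * cor - g * P * vv ->
  P * (du + ud) = P * b2 -> P * (dv + vd) = P * b1 ->
  a / dt' + P * (g + 1 / dt') * (uu + vv) =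
  P * b1 + P * b2 + (-1) * b3 + (-1) * b4 + (-1) * b5.
Proof. lra. Qed.

(** The equations are tested with the new iterate itself.  The Coriolis terms cancel,
    and Green's formula turns the coupling of height and velocity, which has no sign,
    into boundary terms. *)
Lemma energy_identity i :
  ipK i (ev (ph s' i)) (ev (ph s' i)) / dt
  + Phi * (gamma + 1 / dt) * (ipK i (ev (uu s' i)) (ev (uu s' i))
                              + ipK i (ev (vv s' i)) (ev (vv s' i))) =
  \int[arc M]_(x in face i)
    (Num.sqrt Phi * (phat Phi s i x * ev (ph s' i) x)
     - Num.sqrt Phi * (ev (ph s' i) x * ev (ph s' i) x)
     - Phi * (phat Phi s i x * normal_flux s' i x)).
Proof.
have [dp du dv] := deg' i.
have [] := step i dp du dv; rewrite -/f.
set ph' := ev (ph s' i); set u := ev (uu s' i); set v := ev (vv s' i).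
set hat := phat Phi s i.
have cp : continuous ph' by exact: continuous_ev.
have cu : continuous u by exact: continuous_ev.
have cv : continuous v by exact: continuous_ev.
have cdp : continuous (ev (dx (ph s' i))) by exact: continuous_ev.
have cdp' : continuous (ev (dy (ph s' i))) by exact: continuous_ev.
have cdu : continuous (ev (dx (uu s' i))) by exact: continuous_ev.
have cdv : continuous (ev (dy (vv s' i))) by exact: continuous_ev.
have cf := continuous_coriolis.
have cfu : continuous (fun x => f x * u x) by move=> x; apply: cvgM; [exact: cf|exact: cu].
have cfv : continuous (fun x => f x * v x) by move=> x; apply: cvgM; [exact: cf|exact: cv].
have cZ k g : continuous g -> continuous (fun x => k * g x).
  by move=> cg x; apply: cvgM; [exact: cvg_cst|exact: cg].
have tp : tracelike i ph' by exact: tracelike_ev.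
have tu : tracelike i u by exact: tracelike_ev.
have tv : tracelike i v by exact: tracelike_ev.
have th : tracelike i hat by exact: tracelike_phat.
have tn : tracelike i (normal_flux s' i) by exact: tracelike_flux.
have tx := tracelike_nx i; have ty := tracelike_ny i.
have := green_x i (uu s' i) (ph s' i); have := green_y i (vv s' i) (ph s' i).
rewrite -/ph' -/u -/v.
have -> : ipK i (fun x => ph' x / dt) ph' = dt^-1 * ipK i ph' ph'.
  by rewrite -ipKZl//; apply: eq_Rintegral => x _; rewrite [_ / dt]mulrC.
have -> : ipK i (fun x => Phi * u x / dt) u = Phi / dt * ipK i u u.
  by rewrite -ipKZl//; apply: eq_Rintegral => x _; rewrite [_ * u x / dt]mulrAC.
have -> : ipK i (fun x => Phi * v x / dt) v = Phi / dt * ipK i v v.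
  by rewrite -ipKZl//; apply: eq_Rintegral => x _; rewrite [_ * v x / dt]mulrAC.
rewrite !ipKZl//.
have -> : ipK i (fun x => f x * Phi * v x - gamma * Phi * u x) u =
    Phi * ipK i (fun x => f x * v x) u - gamma * Phi * ipK i u u.
  rewrite -mulNr -!ipKZl// -ipKDl//; [|exact: cZ..].
  by apply: eq_Rintegral => x _; congr (_ * _); ring.
have -> : ipK i (fun x => - f x * Phi * u x - gamma * Phi * v x) v =
    - Phi * ipK i (fun x => f x * v x) u - gamma * Phi * ipK i v v.
  have -> : ipK i (fun x => f x * v x) u = ipK i (fun x => f x * u x) v.
    by apply: eq_Rintegral => x _; ring.
  rewrite -(mulNr (gamma * Phi)) -!ipKZl// -ipKDl//; [|exact: cZ..].
  by apply: eq_Rintegral => x _; congr (_ * _); ring.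
have t1 : tracelike i (fun x => Phi * normal_flux s' i x + Num.sqrt Phi * (ph' x - hat x)).
  by apply: tracelikeD; apply: tracelikeZ => //; exact: tracelikeB.
have t2 : tracelike i (fun x => Phi * hat x * nx i x).
  by apply: tracelikeM => //; exact: tracelikeZ.
have t3 : tracelike i (fun x => Phi * hat x * ny i x).
  by apply: tracelikeM => //; exact: tracelikeZ.
have t4 : tracelike i (fun x => u x * nx i x) by exact: tracelikeM.
have t5 : tracelike i (fun x => v x * ny i x) by exact: tracelikeM.
have tM g g' := @tracelikeM _ M i g g'.
rewrite !ipdK_face//.
set b1 := \int[arc M]_(x in face i) _.
set b2 := \int[arc M]_(x in face i) _.
set b3 := \int[arc M]_(x in face i) _.
set b4 := \int[arc M]_(x in face i) _.
set b5 := \int[arc M]_(x in face i) _.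
move=> G1 G2 E1 E2 E3.
have -> : \int[arc M]_(x in face i) (Num.sqrt Phi * (hat x * ph' x) -
      Num.sqrt Phi * (ph' x * ph' x) - Phi * (hat x * normal_flux s' i x))
    = Phi * b1 + Phi * b2 + (-1) * b3 + (-1) * b4 + (-1) * b5.
  rewrite /b1 /b2 /b3 /b4 /b5 -!faceZ; try exact: tM.
  rewrite -!faceD; try by do ?apply: tracelikeD; apply: tracelikeZ; exact: tM.
  by apply: eq_Rintegral => x _; rewrite /normal_flux -/u -/v; ring.
have G1' : Phi * (ipK i ph' (ev (dy (vv s' i))) + ipK i v (ev (dy (ph s' i)))) = Phi * b1.
  by rewrite -G1 [in RHS]ipKC.
have G2' : Phi * (ipK i ph' (ev (dx (uu s' i))) + ipK i u (ev (dx (ph s' i)))) = Phi * b2.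
  by rewrite -G2 [in RHS]ipKC.
exact: energy_algebra E1 E2 E3 G2' G1'.
Qed.

End Energy.

(** * The estimate for one iteration *)

Section Estimate.
Variables (R : realType) (M : mesh R).
Variables (p : nat) (Phi gamma f0 beta0 ym dt : R).
Hypothesis hPhi : 0 < Phi.
Local Notation E := ('I_(nelt M)).
Local Notation sg := (Num.sqrt Phi).
Implicit Types (i j : E) (s : state M) (x : point R).

(** The squared norms are split into height and velocity parts, since the two parts
    enter the estimate with different constants. *)
Definition phi2 s j x : R := ev (ph s j) x * ev (ph s j) x.
Definition theta2 s j x : R :=
  Phi * (ev (uu s j) x * ev (uu s j) x + ev (vv s j) x * ev (vv s j) x).

Lemma tracelike_phi2 s i j : tracelike i (phi2 s j).
Proof. by apply: tracelikeM; exact: tracelike_ev. Qed.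

Lemma tracelike_theta2 s i j : tracelike i (theta2 s j).
Proof.
by apply: tracelikeZ; apply: tracelikeD; apply: tracelikeM; exact: tracelike_ev.
Qed.

Lemma theta2_ge0 s j x : 0 <= theta2 s j x.
Proof. by apply: mulr_ge0; [exact: ltW|rewrite -!expr2 addr_ge0// sqr_ge0]. Qed.

Lemma phi2_ge0 s j x : 0 <= phi2 s j x.
Proof. by rewrite /phi2 -expr2 sqr_ge0. Qed.

Definition skel_phi s := \sum_i \int[arc M]_(x in face i) phi2 s i x.
Definition skel_theta s := \sum_i \int[arc M]_(x in face i) theta2 s i x.

Lemma sqrtM2 (y z : R) : (sg * y) * (sg * z) = Phi * (y * z).
Proof. by rewrite mulrACA -expr2 sqr_sqrtr// ltW. Qed.

Lemma skel_theta_split s i :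
  \int[arc M]_(x in face i) theta2 s i x =
  Phi * (ipdK i (ev (uu s i)) (ev (uu s i)) + ipdK i (ev (vv s i)) (ev (vv s i))).
Proof.
have tM (w : poly2 R) : tracelike i (fun x => ev w x * ev w x).
  by apply: tracelikeM; exact: tracelike_ev.
by rewrite !ipdK_face; try exact: tracelike_ev; rewrite -faceD// -faceZ//; apply: tracelikeD.
Qed.

Lemma sqnorm_skelE s : sqnorm_skel Phi s = skel_phi s + skel_theta s.
Proof.
rewrite /sqnorm_skel /skel_phi /skel_theta -big_split; apply: eq_bigr => i _ /=.
rewrite skel_theta_split -ipdK_face; try exact: tracelike_ev.
rewrite mulrDr; congr (_ + (_ + _)); rewrite !ipdK_face; try exact: tracelike_ev;
  try (by apply: tracelikeZ; exact: tracelike_ev);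
  rewrite -faceZ; try (by apply: tracelikeM; exact: tracelike_ev);
  by apply: eq_Rintegral => x _; exact: sqrtM2.
Qed.

Definition dom_phi s := \sum_i ipK i (ev (ph s i)) (ev (ph s i)).
Definition dom_theta s := \sum_i
  Phi * (ipK i (ev (uu s i)) (ev (uu s i)) + ipK i (ev (vv s i)) (ev (vv s i))).

Lemma sqnorm_domE s : sqnorm_dom Phi s = dom_phi s + dom_theta s.
Proof.
rewrite /sqnorm_dom /dom_phi /dom_theta -big_split; apply: eq_bigr => i _ /=.
have cu := @continuous_ev _ (uu s i); have cv := @continuous_ev _ (vv s i).
rewrite mulrDr -!ipKZl//; congr (_ + (_ + _)).
  by apply: eq_Rintegral => x _; rewrite sqrtM2 mulrA.
by apply: eq_Rintegral => x _; rewrite sqrtM2 mulrA.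
Qed.

Lemma skel_phi_ge0 s : 0 <= skel_phi s.
Proof. by apply: sumr_ge0 => i _; apply: Rintegral_ge0 => x _; exact: phi2_ge0. Qed.

Lemma skel_theta_ge0 s : 0 <= skel_theta s.
Proof. by apply: sumr_ge0 => i _; apply: Rintegral_ge0 => x _; exact: theta2_ge0. Qed.

Lemma dom_theta_ge0 s : 0 <= dom_theta s.
Proof.
apply: sumr_ge0 => i _; apply: mulr_ge0; first exact: ltW.
by apply: addr_ge0; apply: Rintegral_ge0 => x _; rewrite -expr2 sqr_ge0.
Qed.

(** Young's inequality applied to the four products of the expanded numerical
    flux; the difference of the two sides is a sum of squares. *)
Lemma young_flux (S phi q phi_i phi_e q_i q_e A : R) : 0 < S ->
  (S ^+ 2 + S) / 2 <= A -> (1 + S) / 2 <= A ->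
  S * (((phi_i + phi_e) / 2 + S * ((q_i + q_e) / 2)) * phi) - S * (phi * phi)
    - S ^+ 2 * (((phi_i + phi_e) / 2 + S * ((q_i + q_e) / 2)) * q)
  <= A / 2 * ((phi_i ^+ 2 + S ^+ 2 * q_i ^+ 2) + (phi_e ^+ 2 + S ^+ 2 * q_e ^+ 2))
     - (S - S ^+ 2) / 2 * phi ^+ 2 + (1 + S) / 2 * (S ^+ 2 * q ^+ 2).
Proof.
move=> S0 A1 A2.
set a := (phi_i + phi_e) / 2; set b := (q_i + q_e) / 2.
have Sq : 0 < S ^+ 2 by rewrite exprn_gt0.
have sos : S * ((a + S * b) * phi) - S * (phi * phi) - S ^+ 2 * ((a + S * b) * q) <=
    (S ^+ 2 + S) / 2 * a ^+ 2 + (1 + S) / 2 * (S ^+ 2 * b ^+ 2)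
    - (S - S ^+ 2) / 2 * phi ^+ 2 + (1 + S) / 2 * (S ^+ 2 * q ^+ 2).
  rewrite -subr_ge0 (_ : _ - _ = S / 2 * (a - phi) ^+ 2 + S ^+ 2 / 2 * (b - phi) ^+ 2
    + S ^+ 2 / 2 * (a + q) ^+ 2 + S ^+ 2 * S / 2 * (b + q) ^+ 2); last by field.
  by rewrite !addr_ge0// mulr_ge0 ?sqr_ge0// divr_ge0// ?mulr_ge0// ltW.
have avg2 (y z : R) : ((y + z) / 2) ^+ 2 <= (y ^+ 2 + z ^+ 2) / 2.
  rewrite -subr_ge0 (_ : _ - _ = ((y - z) / 2) ^+ 2); last by field.
  exact: sqr_ge0.
have ha : (S ^+ 2 + S) / 2 * a ^+ 2 <= A * ((phi_i ^+ 2 + phi_e ^+ 2) / 2).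
  by apply: ler_pM => //; [lra|exact: sqr_ge0|exact: avg2].
have hb : (1 + S) / 2 * (S ^+ 2 * b ^+ 2) <= A * (S ^+ 2 * ((q_i ^+ 2 + q_e ^+ 2) / 2)).
  apply: ler_pM => //; first lra.
    by rewrite mulr_ge0 ?sqr_ge0// ltW.
  by rewrite ler_pM2l//; exact: avg2.
lra.
Qed.

(** |theta . n| <= |theta| because the normal has length one. *)
Lemma normal_flux_sqr s j x : face j x ->
  Phi * normal_flux s j x ^+ 2 <= theta2 s j x.
Proof.
move=> /face_normal n1; rewrite /theta2 ler_pM2l// -subr_ge0.
rewrite /normal_flux; set u := ev _ x; set v := ev (vv s j) x.
rewrite (_ : _ - _ = (u * ny j x - v * nx j x) ^+ 2
   + (u ^+ 2 + v ^+ 2) * (1 - (nx j x ^+ 2 + ny j x ^+ 2))); last by ring.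
by rewrite n1 subrr mulr0 addr0 sqr_ge0.
Qed.

Let exterior s i x : R :=
  \sum_(j <- index_enum E | j != i) \1_(bd (elt j)) x * (phi2 s j x + theta2 s j x).

Lemma exterior_traces_le s i x : face i x ->
  ext i (fun j => ev (ph s j)) x ^+ 2 + Phi * ext i (normal_flux s) x ^+ 2
  <= exterior s i x.
Proof.
move=> fx.
have h1 := ext_sqr_le (fun j => ev (ph s j)) fx.
have h2 := ext_sqr_le (normal_flux s) fx.
rewrite -(ler_pM2l hPhi) in h2.
apply: (le_trans (lerD h1 h2)); rewrite mulr_sumr -big_split /=.
apply: ler_sum => j _; rewrite indicE; case: (boolP (x \in _)) => [|_].
  rewrite inE !mul1r => /(face_bd fx) fj.
  by rewrite lerD ?normal_flux_sqr// /phi2 expr2.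
by rewrite !mul0r mulr0 addr0.
Qed.

Lemma tracelike_exterior s i : tracelike i (exterior s i).
Proof.
apply: tracelike_sum => j; apply: tracelikeM.
  by apply: tracelike_indic; exact: measurable_bd_elt.
by apply: tracelikeD; [exact: tracelike_phi2|exact: tracelike_theta2].
Qed.

(** Sum of the energy identities, with the boundary terms estimated by [young_flux].
    Each trace of the old iterate is used twice, once from either side, and the
    averages in the numerical flux bring the factor one half that compensates this. *)
Lemma step_estimate s s' A :
  (Phi + sg) / 2 <= A -> (1 + sg) / 2 <= A -> state_deg p s' ->
  ihdg_step p Phi gamma f0 beta0 ym dt s s' ->
  dom_phi s' / dt + (gamma + 1 / dt) * dom_theta s'
  <= A * sqnorm_skel Phi s - (sg - Phi) / 2 * skel_phi s'
     + (1 + sg) / 2 * skel_theta s'.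
Proof.
move=> A1 A2 deg' step.
have sg0 : 0 < sg by rewrite sqrtr_gt0.
have sg2 : sg ^+ 2 = Phi by rewrite sqr_sqrtr// ltW.
have A0 : 0 <= A by rewrite (le_trans _ A2)// divr_ge0// addr_ge0// ltW.
pose g i x := phi2 s i x + theta2 s i x.
have tg i j : tracelike i (g j).
  by apply: tracelikeD; [exact: tracelike_phi2|exact: tracelike_theta2].
have local i : ipK i (ev (ph s' i)) (ev (ph s' i)) / dt
  + Phi * (gamma + 1 / dt) * (ipK i (ev (uu s' i)) (ev (uu s' i))
                              + ipK i (ev (vv s' i)) (ev (vv s' i))) <=
    A / 2 * \int[arc M]_(x in face i) g i x
    + A / 2 * \int[arc M]_(x in face i) exterior s i x
    + - ((sg - Phi) / 2) * \int[arc M]_(x in face i) phi2 s' i x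
    + (1 + sg) / 2 * \int[arc M]_(x in face i) theta2 s' i x.
  rewrite (energy_identity deg' step).
  have te := tracelike_exterior s i; have tp := tracelike_phi2 s' i i.
  have tt := tracelike_theta2 s' i i.
  have tE := tracelike_ev i (ph s' i); have tH := tracelike_phat Phi s i.
  have tF := tracelike_flux s' i.
  rewrite -!faceZ// -faceD; try exact: tracelikeZ.
  rewrite -faceD; try (by apply: tracelikeZ); last first.
    by apply: tracelikeD; exact: tracelikeZ.
  rewrite -faceD; try (by apply: tracelikeZ); last first.
    by apply: tracelikeD; [apply: tracelikeD|]; exact: tracelikeZ.
  apply: face_le.
  - by apply: tracelikeB; [apply: tracelikeB|]; apply: tracelikeZ; exact: tracelikeM.
  - by apply: tracelikeD; [apply: tracelikeD; [apply: tracelikeD|]|]; exact: tracelikeZ.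
  move=> x fx.
  have Y := @young_flux sg (ev (ph s' i) x) (normal_flux s' i x)
    (ev (ph s i) x) (ext i (fun j => ev (ph s j)) x)
    (normal_flux s i x) (ext i (normal_flux s) x) A sg0.
  rewrite sg2 in Y; have {}Y := Y A1 A2.
  rewrite /phat /avg; apply: (le_trans Y).
  have n1 := normal_flux_sqr s fx; have n2 := normal_flux_sqr s' fx.
  have ex := exterior_traces_le s fx.
  have h1 : A / 2 * (ev (ph s i) x ^+ 2 + Phi * normal_flux s i x ^+ 2
      + (ext i (fun j => ev (ph s j)) x ^+ 2 + Phi * ext i (normal_flux s) x ^+ 2))
      <= A / 2 * (g i x + exterior s i x).
    apply: ler_wpM2l; first by rewrite divr_ge0.
    by rewrite lerD// /g lerD// /phi2 expr2.
  have h2 : (1 + sg) / 2 * (Phi * normal_flux s' i x ^+ 2) <= (1 + sg) / 2 * theta2 s' i x.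
    by apply: ler_wpM2l => //; rewrite divr_ge0// addr_ge0// ltW.
  by rewrite [phi2 s' i x]/phi2 -expr2; lra.
have extE : \sum_i \int[arc M]_(x in face i) exterior s i x <=
            \sum_i \int[arc M]_(x in face i) g i x.
  apply: sum_exterior_le => [j|j x]; first exact: tg.
  apply: addr_ge0; [exact: phi2_ge0|exact: theta2_ge0].
have gE : \sum_i \int[arc M]_(x in face i) g i x = sqnorm_skel Phi s.
  rewrite sqnorm_skelE -big_split; apply: eq_bigr => i _ /=.
  by rewrite -faceD//; [exact: tracelike_phi2|exact: tracelike_theta2].
have total : dom_phi s' / dt + (gamma + 1 / dt) * dom_theta s' <=
    A / 2 * sqnorm_skel Phi s
    + A / 2 * (\sum_i \int[arc M]_(x in face i) exterior s i x)
    + - ((sg - Phi) / 2) * skel_phi s' + (1 + sg) / 2 * skel_theta s'.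
  rewrite /dom_phi /dom_theta /skel_phi /skel_theta -gE mulr_suml !mulr_sumr -!big_split /=.
  apply: ler_sum => i _; apply: le_trans (local i).
  by rewrite mulrA [_ * Phi]mulrC.
have : A / 2 * (\sum_i \int[arc M]_(x in face i) exterior s i x) <= A / 2 * sqnorm_skel Phi s.
  by apply: ler_wpM2l; [rewrite divr_ge0|rewrite -gE].
lra.
Qed.

End Estimate.

Unset Implicit Arguments.

Theorem theorem3p4 (R : realType) (M : mesh R) (p : nat)
  (Phi gamma f0 beta0 ym dt c : R) (s : nat -> state M)
  (hPhi : 0 < Phi) (hgamma : 0 <= gamma) (hdt : 0 < dt)
  (hc0 : 0 < c) (hc1 : c <= 1) (hc : inverse_trace M p c)
  (hdeg : forall k, state_deg p (s k))
  (hstep : forall k, ihdg_step p Phi gamma f0 beta0 ym dt (s k) (s k.+1)) :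
  let h := mesh_size M in
  let A := Num.max ((Phi + Num.sqrt Phi) / 2) ((1 + Num.sqrt Phi) / 2) in
  let B := Num.min
    (c * h / (dt * (p.+1)%:R * (p.+2)%:R) + (Num.sqrt Phi - Phi) / 2)
    ((gamma + 1 / dt) * (c * h / ((p.+1)%:R * (p.+2)%:R))
     - (1 + Num.sqrt Phi) / 2) in
  let C := A / B in
  0 < B -> C < 1 ->
  [/\ (fun k => sqnorm_skel Phi (s k)) @ \oo --> (0 : R),
      (fun k => sqnorm_dom Phi (s k)) @ \oo --> (0 : R)
    & forall k : nat, (1 <= k)%N ->
        sqnorm_skel Phi (s k) <= C ^+ k * sqnorm_skel Phi (s 0%N) /\
        sqnorm_dom Phi (s k)
          <= dt * A * (C + 1) * C ^+ k.-1 * sqnorm_skel Phi (s 0%N)].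
Proof.
move=> h A B C B0 C1.
set T := fun k => sqnorm_skel Phi (s k).
pose sg := Num.sqrt Phi.
have sg0 : 0 < sg by rewrite sqrtr_gt0.
have A1 : (Phi + sg) / 2 <= A by rewrite le_max lexx.
have A2 : (1 + sg) / 2 <= A by rewrite le_max lexx orbT.
have A0 : 0 < A by rewrite (lt_le_trans _ A2)// divr_gt0// addr_gt0.
have C0 : 0 <= C by rewrite divr_ge0// ltW.
(* The constant of the inverse trace inequality, by which the volume terms of the
   energy absorb the boundary terms of the new iterate. *)
pose kap : R := c * h / ((p.+1)%:R * (p.+2)%:R).
have B1 : B <= kap / dt + (sg - Phi) / 2.
  have -> : kap / dt = c * h / (dt * (p.+1)%:R * (p.+2)%:R).
    by rewrite /kap !invfM; ring.
  by rewrite ge_min lexx.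
have B2 : B <= (gamma + 1 / dt) * kap - (1 + sg) / 2 by rewrite ge_min lexx orbT.
have trace_ineq (i : 'I_(nelt M)) (w : poly2 R) : Pdeg p w ->
    kap * ipdK i (ev w) (ev w) <= ipK i (ev w) (ev w).
  move=> /hc -/(_ i); rewrite -/h.
  have -> // : 2 * c * h / (2 * (p.+1)%:R * (p.+2)%:R) = kap.
  by rewrite /kap -(mulrA 2 c h) -(mulrA 2 p.+1%:R) -mulf_div divff// mul1r.
have T0 k : 0 <= T k by rewrite /T sqnorm_skelE// addr_ge0// ?skel_phi_ge0// skel_theta_ge0.
have phi_trace k : kap * skel_phi (s k) <= dom_phi (s k).
  rewrite mulr_sumr; apply: ler_sum => i _.
  rewrite -ipdK_face; try exact: tracelike_ev.
  by have [dp _ _] := hdeg k i; exact: trace_ineq.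
have theta_trace k : kap * skel_theta Phi (s k) <= dom_theta Phi (s k).
  rewrite mulr_sumr; apply: ler_sum => i _.
  rewrite skel_theta_split mulrCA ler_pM2l// mulrDr.
  by have [_ du dv] := hdeg k i; rewrite lerD// trace_ineq.
have est k := step_estimate hPhi A1 A2 (hdeg k.+1) (hstep k).
have P0 k : 0 <= skel_phi (s k) by exact: skel_phi_ge0.
have Q0 k : 0 <= skel_theta Phi (s k) by exact: skel_theta_ge0.
have gdt : 0 <= gamma + 1 / dt by rewrite addr_ge0// divr_ge0// ltW.
have skel_step k : T k.+1 <= C * T k.
  rewrite /C mulrAC ler_pdivlMr// mulrC.
  have h1 : kap / dt * skel_phi (s k.+1) <= dom_phi (s k.+1) / dt.
    by rewrite mulrAC ler_pM2r ?invr_gt0//.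
  have h2 : (gamma + 1 / dt) * (kap * skel_theta Phi (s k.+1))
            <= (gamma + 1 / dt) * dom_theta Phi (s k.+1) by exact: ler_wpM2l.
  have h3 := ler_wpM2r (P0 k.+1) B1; have h4 := ler_wpM2r (Q0 k.+1) B2.
  have := est k; rewrite -/(T k) /T (sqnorm_skelE hPhi (s k.+1)) -/sg; lra.
have skel_pow k : T k <= C ^+ k * T 0%N.
  elim: k => [|k IH]; first by rewrite expr0 mul1r.
  by rewrite exprS -mulrA (le_trans (skel_step k))// ler_wpM2l.
have dom_step k : sqnorm_dom Phi (s k.+1) <= dt * A * (C + 1) * T k.
  have h1 : (sqnorm_dom Phi (s k.+1)) / dt <= A * T k + A * T k.+1.
    have h2 : 0 <= gamma * dom_theta Phi (s k.+1).
      by rewrite mulr_ge0// dom_theta_ge0.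
    have h3 : (Phi - sg) / 2 <= A by rewrite (le_trans _ A1)//; lra.
    have h4 := ler_wpM2r (P0 k.+1) h3; have h5 := ler_wpM2r (Q0 k.+1) A2.
    have := est k; rewrite -/(T k) /T (sqnorm_skelE hPhi (s k.+1)) sqnorm_domE// -/sg.
    lra.
  rewrite ler_pdivrMr// in h1; apply: (le_trans h1).
  have := skel_step k; rewrite -(ler_pM2l A0) => h2.
  rewrite (_ : dt * A * (C + 1) * T k = (A * T k + A * (C * T k)) * dt); last by ring.
  by rewrite ler_pM2r// lerD2l.
have K0 : 0 <= dt * A * (C + 1) by rewrite !mulr_ge0 ?addr_ge0// ltW.
have dom_pow k : sqnorm_dom Phi (s k.+1) <= dt * A * (C + 1) * C ^+ k * T 0%N.
  by rewrite (le_trans (dom_step k))// -[leRHS]mulrA ler_wpM2l.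
have Ccvg : (fun k => C ^+ k) @ \oo --> (0 : R) by apply: cvg_expr; rewrite ger0_norm.
split.
- apply: (@squeeze_cvgr _ _ _ _ (fun=> 0) (fun k => C ^+ k * T 0%N)).
  + by apply: nearW => k; rewrite T0 skel_pow.
  + exact: cvg_cst.
  + by rewrite -(mul0r (T 0%N)); apply: cvgM => //; exact: cvg_cst.
- rewrite -(cvg_shiftS (fun k => sqnorm_dom Phi (s k))) /=.
  apply: (@squeeze_cvgr _ _ _ _ (fun=> 0) (fun k => dt * A * (C + 1) * C ^+ k * T 0%N)).
  + apply: nearW => k; rewrite dom_pow andbT sqnorm_domE// addr_ge0 ?dom_theta_ge0//.
    by apply: sumr_ge0 => i _; apply: Rintegral_ge0 => x _; rewrite -expr2 sqr_ge0.
  + exact: cvg_cst.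
  + rewrite -[X in _ --> X](mul0r (T 0%N)); apply: cvgM; last exact: cvg_cst.
    rewrite -[X in _ --> X](mulr0 (dt * A * (C + 1))).
    by apply: cvgM => //; exact: cvg_cst.
- by move=> [//|k] _; split; [exact: skel_pow|exact: dom_pow].
Qed.
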